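(* Let $G$ be a compact Hausdorff group with normalized Haar measure $m_G$, let $(\Phi,\Psi)$ be a pair of complementary Young functions both satisfying the $\Delta_2$-condition, and let $\mu\in M(G)$. Suppose that a Bochner integrable function $F:G\to L^\Phi(G)$ satisfies $\nu_{\Phi,\mu}(A)=\int_AF\,dm_G$ for all Borel sets $A\subseteq G$. Then there exists $f\in L^\Phi(G)$ such that $d\mu=f\,dm_G$.
   Context: $M(G)$ is the space of bounded complex Radon measures on $G$. Young function: convex $\Phi:[0,\infty]\to[0,\infty]$, $\Phi(0)=0$, $\lim_{x\to\infty}\Phi(x)=\infty$; complementary $\Psi(y)=\sup\{xy-\Phi(x):x\ge0\}$; $\Delta_2$: $\exists K,x_0>0$, $\Phi(2x)\le K\Phi(x)$ for $x\ge x_0$. $L^\Phi(G)$: Orlicz space with Luxemburg norm $\|f\|_\Phi=\inf\{k>0:\int_G\Phi(|f|/k)dm_G\le1\}$. For $\mu\in M(G)$, $f\in L^1(G)$: $\mu*f(t)=\int_Gf(s^{-1}t)\,d\mu(s)$; $\nu_{\Phi,\mu}:\mathcal{B}(G)\to L^\Phi(G)$ is the vector measure $\nu_{\Phi,\mu}(A)=\mu*\chi_A$. *)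

(* Defs.v *)
From HB Require Import structures.
From mathcomp Require Import all_boot all_order all_algebra.
From mathcomp Require Import all_classical all_reals all_analysis.
From mathcomp Require complex.
From Stdlib Require List.
Import Order.TTheory GRing.Theory Num.Theory.
Import numFieldNormedType.Exports.

Set Implicit Arguments.
Unset Strict Implicit.
Unset Printing Implicit Defensive.

Local Open Scope classical_set_scope.
Local Open Scope ring_scope.

Notation Cplx R := (complex.complex R).
Notation cRe := complex.Re.
Notation cIm := complex.Im.

Notation Borel T := (g_sigma_algebraType (@open T)).

Section Defs.
Context {R : realType}.

(* A Young function Phi : [0,oo] -> [0,oo]; it is given on the reals
   x >= 0 (values at x < 0 are irrelevant), may take the value +oo, and its
   value at +oo is the limit (which must be +oo). *)
Definition young_function (Phi : R -> \bar R) : Prop :=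
  [/\ Phi 0 = 0%E,
      (forall x, 0 <= x -> (0 <= Phi x)%E),
      (forall x y l : R, 0 <= x -> 0 <= y -> 0 <= l -> l <= 1 ->
         (Phi (l * x + (1 - l) * y)%R <= l%:E * Phi x + (1 - l)%R%:E * Phi y)%E)
    & Phi x @[x --> +oo] --> +oo%E].

Definition complementary_fun (Phi : R -> \bar R) (y : R) : \bar R :=
  ereal_sup [set ((x * y)%:E - Phi x)%E | x in [set x : R | 0 <= x]].

Definition complementary_pair (Phi Psi : R -> \bar R) : Prop :=
  [/\ young_function Phi, young_function Psi &
      forall y, 0 <= y -> Psi y = complementary_fun Phi y].

Definition Delta2 (Phi : R -> \bar R) : Prop :=
  exists K x0 : R, [/\ 0 < K, 0 < x0 &
    forall x, x0 <= x -> (Phi (2 * x)%R <= K%:E * Phi x)%E].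

Definition cabs (z : Cplx R) : R := Num.sqrt (cRe z ^+ 2 + cIm z ^+ 2).

Definition csub {T : Type} (f g : T -> Cplx R) : T -> Cplx R :=
  fun t => complex.Complex (cRe (f t) - cRe (g t)) (cIm (f t) - cIm (g t)).

Context {T : ptopologicalType}.

(* Luxemburg norm (+oo if no k works) *)
Definition luxemburg_norm (Phi : R -> \bar R) (m : set (Borel T) -> \bar R)
    (f : T -> Cplx R) : \bar R :=
  ereal_inf [set k%:E | k in [set k : R | 0 < k /\
     (\int[m]_(x in [set: Borel T]) Phi (cabs (f x) / k)%R <= 1)%E]].

Definition in_Orlicz (Phi : R -> \bar R) (m : set (Borel T) -> \bar R)
    (f : T -> Cplx R) : Prop :=
  [/\ measurable_fun [set: Borel T] (fun x : Borel T => cRe (f x)),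
      measurable_fun [set: Borel T] (fun x : Borel T => cIm (f x)) &
      (luxemburg_norm Phi m f < +oo)%E].

Definition topological_group (mul : T -> T -> T) (inv : T -> T) (e : T) :=
  [/\ associative mul, left_id e mul, left_inverse e inv mul,
      continuous (fun p : T * T => mul p.1 p.2) & continuous inv].

Definition radon (mu : set (Borel T) -> \bar R) : Prop :=
  forall A : set (Borel T), measurable A ->
    mu A = ereal_sup [set mu K | K in [set K : set T | compact K /\ K `<=` A]]
 /\ mu A = ereal_inf [set mu U | U in [set U : set T | open U /\ A `<=` U]].

Definition normalized_haar (mul : T -> T -> T) (m : set (Borel T) -> \bar R) :=
  [/\ m [set: T] = 1%E, radon m &
      forall (x : T) (A : set (Borel T)), measurable A -> m (mul x @` A) = m A].

(* A bounded complex Radon measure mu is given by four finite positive Radon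
   measures: mu = (mu1 - mu2) + i (mu3 - mu4). *)
Definition cmeasure_val (mu1 mu2 mu3 mu4 : set (Borel T) -> \bar R)
    (A : set T) : Cplx R :=
  complex.Complex (fine (mu1 A) - fine (mu2 A)) (fine (mu3 A) - fine (mu4 A)).

Definition cconv (mul : T -> T -> T) (inv : T -> T)
    (mu1 mu2 mu3 mu4 : set (Borel T) -> \bar R) (f : T -> R) : T -> Cplx R :=
  fun t => complex.Complex
    (fine (\int[mu1]_(s in [set: Borel T]) (f (mul (inv s) t))%:E)%E
      - fine (\int[mu2]_(s in [set: Borel T]) (f (mul (inv s) t))%:E)%E)
    (fine (\int[mu3]_(s in [set: Borel T]) (f (mul (inv s) t))%:E)%E
      - fine (\int[mu4]_(s in [set: Borel T]) (f (mul (inv s) t))%:E)%E).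

Definition nu_mu mul inv (mu1 mu2 mu3 mu4 : set (Borel T) -> \bar R)
    (A : set T) : T -> Cplx R :=
  cconv mul inv mu1 mu2 mu3 mu4 (\1_A).

(* L^Phi-valued simple functions: x |-> sum_i chi_{A_i}(x) g_i *)
Definition lsimple := seq (set T * (T -> Cplx R)).

Definition lsimple_ok Phi (m : set (Borel T) -> \bar R) (s : lsimple) :=
  forall p, List.In p s -> measurable (p.1 : set (Borel T)) /\ in_Orlicz Phi m p.2.

Definition lsimple_eval (s : lsimple) (x : T) : T -> Cplx R :=
  fun t => complex.Complex (\sum_(p <- s) \1_(p.1) x * cRe (p.2 t))
                           (\sum_(p <- s) \1_(p.1) x * cIm (p.2 t)).

Definition lsimple_int (m : set (Borel T) -> \bar R) (s : lsimple) (E : set T)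
    : T -> Cplx R :=
  fun t => complex.Complex (\sum_(p <- s) fine (m (E `&` p.1)) * cRe (p.2 t))
                           (\sum_(p <- s) fine (m (E `&` p.1)) * cIm (p.2 t)).

Definition bochner_approx Phi (m : {measure set (Borel T) -> \bar R})
    (F : T -> T -> Cplx R) (Fn : nat -> lsimple) : Prop :=
  [/\ forall n, lsimple_ok Phi m (Fn n),
      forall x, in_Orlicz Phi m (F x),
      {ae m, forall x : Borel T,
         (fun n => luxemburg_norm Phi m (csub (lsimple_eval (Fn n) x) (F x)))
           @ \oo --> (0 : \bar R)} &
      (fun n => (\int[m]_(x in [set: Borel T])
          luxemburg_norm Phi m (csub (lsimple_eval (Fn n) x) (F x)))%E)
           @ \oo --> (0 : \bar R)].

Definition bochner_integrable Phi (m : {measure set (Borel T) -> \bar R})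
    (F : T -> T -> Cplx R) : Prop :=
  exists Fn, bochner_approx Phi m F Fn.

(* g is (a representative of) the Bochner integral int_A F dm in L^Phi:
   it is the L^Phi-limit of int_A Fn dm for an approximating sequence Fn
   (the limit does not depend on the approximating sequence). *)
Definition is_bochner_integral Phi (m : {measure set (Borel T) -> \bar R})
    (F : T -> T -> Cplx R) (A : set T) (g : T -> Cplx R) : Prop :=
  exists Fn, bochner_approx Phi m F Fn /\
    (fun n => luxemburg_norm Phi m (csub (lsimple_int m (Fn n) A) g))
      @ \oo --> (0 : \bar R).

End Defs.

(* Main.v *)
Require Import Defs.
From Stdlib Require List.
From HB Require Import structures.
From mathcomp Require Import finmap.
From mathcomp Require Import all_boot all_order all_algebra.
From mathcomp Require Import all_classical all_reals all_analysis.
From mathcomp Require Import measurable_realfun.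
From mathcomp Require complex.
From mathcomp Require Import ring lra.
Import Order.TTheory GRing.Theory Num.Theory.
Import numFieldNormedType.Exports.
Local Open Scope classical_set_scope.
Local Open Scope ring_scope.

(** Since [L^Phi] embeds in [L^1], it is enough to work with the [L^1]-distance
and with real and imaginary parts.  For a continuous [phi], pairing
[nu(U) = int_U F] with [phi] for [U] open and applying Fubini to continuous
kernels gives [<F x, phi> = int phi(s x) dmu(s)] for almost every [x]; the
exceptional set depends on [phi], and there may be uncountably many [phi] to
handle since [G] need not be metrizable.  The right-hand side is continuous in
[x], while [F] has essentially separable range: up to a null set, [G] is a
countable union of sets [B] on which [F] oscillates by at most [eps] in [L^1].
Almost every point [x] of such a [B] is a point of the support of [B], so that
the identity holds at points of [B] arbitrarily close to [x], and hence at [x]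
itself up to [eps |phi|], for all [phi] at once.  Fixing one good [x], the
right translate of [mu] by [x] has density [F x]; as the Haar measure of a
compact group is right invariant, [mu] has density [t |-> F x (t x)], which
belongs to [L^Phi] because [F x] does. *)

Set Implicit Arguments.
Unset Strict Implicit.
Unset Printing Implicit Defensive.

(** Two measurability obstacles shape the argument. The Borel sigma-algebra of G x G may exceed the
    product sigma-algebra, so Fubini does not apply directly to the indicator of the pairs (s, t)
    with s^-1 t in A. The equation for nu is therefore exploited for open U only: by inner
    regularity, the mass of the s with s^-1 t in U is then lower semicontinuous in t. A continuous h
    with values in [0, 1] is a uniform limit of averages of indicators of the open sets h > k/n,
    which leads back to continuous kernels; other Borel sets are reached through regularity.
    Secondly, the Luxemburg distance from F_n x to F x is not known to be measurable in x, so its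
    integral is a lower integral: it is only compared by monotonicity, and limits are replaced by
    measurable versions. The formula for <F x, phi> comes from the substitution t = s x in the
    double integral of phi(t) h(s^-1 t), which turns it into that of phi(s x) h(x). *)

Section generic_measure.
Context d (X : measurableType d) (R : realType).

Import HBNNSimple.

(* For a nonnegative function that is not measurable, the library integral is a
   lower integral; it is still monotone. *)
Lemma le_lower_integral (m : {measure set X -> \bar R}) (f g : X -> \bar R) :
  (forall x, 0 <= f x)%E -> (forall x, f x <= g x)%E ->
  (\int[m]_x f x <= \int[m]_x g x)%E.
Proof.
move=> f0 fg; rewrite !ge0_integralTE//; last first.
  by move=> x; exact: le_trans (f0 x) (fg x).
apply: ereal_sup_le => _ [h hf <-]; exists h => //.
by move=> x; exact: le_trans (hf x) (fg x).
Qed.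

Lemma bounded_integrable (m : {finite_measure set X -> \bar R}) (f : X -> R)
    (M : R) :
  measurable_fun setT f -> (forall x, `|f x| <= M) ->
  m.-integrable setT (EFin \o f).
Proof.
move=> mf fM; apply: measurable_bounded_integrable => //.
  by rewrite ltey_eq fin_num_measure.
exists M; split => [|y My x _]; first exact: num_real.
by apply: le_trans (fM x) _; exact: ltW.
Qed.

Lemma bounded_mul_integrable (m : {measure set X -> \bar R}) (h g : X -> R)
    (M : R) :
  measurable_fun setT h -> (forall x, `|h x| <= M) ->
  m.-integrable setT (EFin \o g) ->
  m.-integrable setT (EFin \o (fun x => h x * g x)).
Proof.
move=> mh hM ig.
rewrite (_ : EFin \o _ = (EFin \o h) \* (EFin \o g))%E; last first.
  by apply/funext => x /=; rewrite EFinM.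
apply: integrableMr => //.
exists M; split => [|y My x _]; first exact: num_real.
by apply: le_trans (hM x) _; exact: ltW.
Qed.

Lemma le_bounded_mul_Rintegral (m : {measure set X -> \bar R}) (h g : X -> R)
    (M : R) :
  measurable_fun setT h -> (forall x, `|h x| <= M) ->
  m.-integrable setT (EFin \o g) ->
  `|\int[m]_x (h x * g x)| <= M * \int[m]_x `|g x|.
Proof.
move=> mh hM ig; have ihg := bounded_mul_integrable mh hM ig.
apply: (le_trans (le_normr_Rintegral _ ihg)) => //.
rewrite -RintegralZl//; last exact: integrable_norm.
apply: le_Rintegral => //.
- exact: (integrable_norm ihg).
- under [X in integrable _ _ X]eq_fun do rewrite /= EFinM.
  by apply: integrableZl => //; exact: (integrable_norm ig).
- by move=> x _; rewrite normrM ler_wpM2r.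
Qed.

Lemma integrable_EFinD (m : {measure set X -> \bar R}) (f g : X -> R) :
  m.-integrable setT (EFin \o f) -> m.-integrable setT (EFin \o g) ->
  m.-integrable setT (EFin \o (fun x => f x + g x)).
Proof. by move=> fi gi; apply: (integrableD measurableT fi gi). Qed.

Lemma integrable_EFinB (m : {measure set X -> \bar R}) (f g : X -> R) :
  m.-integrable setT (EFin \o f) -> m.-integrable setT (EFin \o g) ->
  m.-integrable setT (EFin \o (fun x => f x - g x)).
Proof. by move=> fi gi; apply: (integrableB measurableT fi gi). Qed.

Lemma integrable_EFinZ (m : {measure set X -> \bar R}) (c : R) (f : X -> R) :
  m.-integrable setT (EFin \o f) ->
  m.-integrable setT (EFin \o (fun x => c * f x)).
Proof. by move=> fi; apply: (integrableZl measurableT c fi). Qed.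

Lemma integrable_EFin_sum (m : {measure set X -> \bar R}) (I : Type)
    (s : seq I) (f : I -> X -> R) :
  (forall i, List.In i s -> m.-integrable setT (EFin \o f i)) ->
  m.-integrable setT (EFin \o (fun x => \sum_(i <- s) f i x)).
Proof.
elim: s => [_|i s ih fi].
  by under eq_fun do rewrite big_nil; exact: integrable0.
have -> : (fun x => \sum_(j <- i :: s) f j x) =
          (fun x => f i x + \sum_(j <- s) f j x).
  by apply/funext => x; rewrite big_cons.
apply: integrable_EFinD; first by apply: fi; left.
by apply: ih => j js; apply: fi; right.
Qed.

Lemma Rintegral_sum (m : {measure set X -> \bar R}) (I : Type)
    (s : seq I) (f : I -> X -> R) :
  (forall i, List.In i s -> m.-integrable setT (EFin \o f i)) ->
  \int[m]_x (\sum_(i <- s) f i x) = \sum_(i <- s) \int[m]_x f i x.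
Proof.
elim: s => [_|i s ih fi].
  by under eq_Rintegral do rewrite big_nil; rewrite Rintegral_cst// mul0r big_nil.
under eq_Rintegral do rewrite big_cons.
rewrite RintegralD//; last 2 first.
- by apply: fi; left.
- by apply: integrable_EFin_sum => j js; apply: fi; right.
rewrite big_cons ih// => j js; by apply: fi; right.
Qed.

End generic_measure.

(** * Borel sets and continuous functions *)

Section borel.
Context {R : realType} {T : ptopologicalType}.

Lemma open_Borel (U : set T) : open U -> measurable (U : set (Borel T)).
Proof. exact: sub_sigma_algebra. Qed.

Lemma closed_Borel (U : set T) : closed U -> measurable (U : set (Borel T)).
Proof.
move=> cU; rewrite -(setCK U); apply: measurableC; apply: open_Borel.
exact: closed_openC.
Qed.

Lemma continuous_Borel (f : T -> R) : continuous f ->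
  measurable_fun setT (f : Borel T -> R).
Proof.
move=> cf; apply: (measurability _ (RGenOInfty.measurableE R)) => //.
move=> _ [_ [a ->]] <-; rewrite setTI; apply: open_Borel.
move/continuousP : cf; apply; exact: interval_open.
Qed.

Lemma continuous_Borel_Borel (f : T -> T) : continuous f ->
  measurable_fun setT (f : Borel T -> Borel T).
Proof.
move=> cf; apply: (@measurability _ _ (Borel T) (Borel T) setT f (@open T) erefl).
move=> _ [A oA <-]; rewrite setTI; apply: open_Borel.
by move/continuousP : cf; apply.
Qed.

Lemma compact_continuous_bounded (X : topologicalType) (f : X -> R) :
  compact [set: X] ->
  continuous f -> exists2 M, 0 < M & forall x, `|f x| <= M.
Proof.
move=> cT cf.
have : compact (f @` setT).
  by apply: continuous_compact => //; exact: continuous_subspaceT.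
move/compact_bounded => [M [_ MP]].
exists (`|M| + 1) => [|x]; first by rewrite ltr_wpDl.
apply: (MP (`|M| + 1)); last by exists x.
by rewrite ltr_pwDr// ler_norm.
Qed.

Lemma continuous_integrable (m : {finite_measure set (Borel T) -> \bar R})
    (f : T -> R) : compact [set: T] -> continuous f ->
  m.-integrable setT (EFin \o f).
Proof.
move=> cT cf; have [M _ fM] := compact_continuous_bounded cT cf.
exact: bounded_integrable (continuous_Borel cf) fM.
Qed.

End borel.

(** * Regular measures *)

(** The restriction of [m] to the whole space carries the finite-measure structure and has the same
    values. *)
Lemma finite_measure_of d (X : measurableType d) (R : realType)
    (m : {measure set X -> \bar R}) : (m setT < +oo)%E ->
  exists nu : {finite_measure set X -> \bar R},
    nu = m :> (set X -> \bar R).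
Proof.
move=> mT.
exists (mfrestr measurableT mT); apply/funext => A.
exact: (congr1 m (setIT A)).
Qed.

Lemma pushforward_finite_measure d (X : measurableType d) (R : realType)
    (m : {finite_measure set X -> \bar R}) (f : X -> X) :
  measurable_fun setT f ->
  exists nu : {finite_measure set X -> \bar R},
    nu = pushforward m f :> (set X -> \bar R).
Proof.
move=> mf.
have [nu0 nu0E] : exists nu : {measure set X -> \bar R},
    nu = pushforward m f :> (set X -> \bar R).
  by unshelve eexists (pushforward m f).
have [|nu nuE] := @finite_measure_of _ _ _ nu0; last by exists nu; rewrite nuE.
by rewrite nu0E /pushforward preimage_setT ltey_eq fin_num_measure.
Qed.

Section regular.
Context {R : realType} {T : ptopologicalType}.
Implicit Types nu : {finite_measure set (Borel T) -> \bar R}.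

(** Inner and outer regularity in a single inequality. Shrinking [U] and enlarging [K] preserve it,
    so one pair can serve several measures at once. *)
Definition regular_measure (nu : set (Borel T) -> \bar R) :=
  forall (A : set (Borel T)) (eps : R), measurable A -> 0 < eps ->
  exists K U : set T, [/\ compact K, open U, K `<=` A, A `<=` U &
    (nu (U `\` K) < eps%:E)%E].

Lemma radon_regular nu : hausdorff_space T -> radon nu -> regular_measure nu.
Proof.
move=> hT rnu A eps mA e0.
have e20 : 0 < eps / 2 by rewrite divr_gt0.
have finA := fin_num_measure nu _ mA.
have [rK rU] := rnu A mA.
have fK : ereal_sup [set nu K | K in [set K | compact K /\ K `<=` A]]
  \is a fin_num by rewrite -rK; exact: finA.
have fU : ereal_inf [set nu U | U in [set U | open U /\ A `<=` U]]
  \is a fin_num by rewrite -rU; exact: finA.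
have [_ [K [cK KA] <-] nuK] := ub_ereal_sup_adherent e20 fK.
have [_ [U [oU AU] <-] nuU] := lb_ereal_inf_adherent e20 fU.
rewrite -rK in nuK; rewrite -rU in nuU.
have mK : measurable (K : set (Borel T)).
  by apply: closed_Borel; exact: compact_closed.
have mU : measurable (U : set (Borel T)) by exact: open_Borel.
exists K, U; split => //.
suff : (nu U - nu K < eps%:E)%E.
  rewrite measureD//; last by rewrite ltey_eq fin_num_measure.
  by rewrite setIidr//; exact: subset_trans KA AU.
have {}nuK : (nu A - (eps / 2)%:E < nu K)%E := nuK.
have {}nuU : (nu U < nu A + (eps / 2)%:E)%E := nuU.
have fineE (B : set (Borel T)) : measurable B -> nu B = (fine (nu B))%:E.
  by move=> mB; rewrite fineK// fin_num_measure.
move: nuK nuU; rewrite (fineE A)// (fineE U)// (fineE K)// -!EFinB -EFinD !lte_fin.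
by move: (fine _) (fine _) (fine _) => a b c; clear; lra.
Qed.

(** A homeomorphism transports the sandwich: [K] is pushed by [f], [U] is pulled back by its inverse
    [g], and the preimage of the new gap is the old one. *)
Lemma pushforward_regular nu (f g : T -> T) : hausdorff_space T ->
  continuous f -> continuous g -> cancel g f -> cancel f g ->
  regular_measure nu -> regular_measure (pushforward nu (f : Borel T -> Borel T)).
Proof.
move=> hT cf cg gK fK rnu A eps mA e0.
have mfA : measurable (f @^-1` A : set (Borel T)).
  by rewrite -[X in measurable X]setTI; exact: continuous_Borel_Borel.
have [K [U [cK oU KA AU nuUK]]] := rnu _ _ mfA e0.
exists (f @` K), (g @^-1` U); split.
- by apply: continuous_compact => //; exact: continuous_subspaceT.
- by move/continuousP : cg; apply.
- by move=> _ [x Kx <-]; exact: KA.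
- by move=> x Ax; apply: AU; rewrite /= gK.
- have e : f @^-1` (g @^-1` U `\` f @` K) = U `\` K.
    apply/seteqP; split => x /=; rewrite fK => -[Ux nKx]; split=> //.
      by move=> Kx; apply: nKx; exists x.
    by move=> [y Ky fyx]; apply: nKx; rewrite -(fK x) -fyx fK.
  by rewrite /pushforward; rewrite -e in nuUK.
Qed.

(** The difference of [phi] and the indicator of [A] vanishes on [K] and off [U], and is at most 1
    in absolute value in between. *)
Lemma sandwich_Rintegral nu (K A U : set (Borel T)) (phi g : T -> R) :
  measurable K -> measurable A -> measurable U -> K `<=` A -> A `<=` U ->
  measurable_fun setT (phi : Borel T -> R) ->
  (forall x, 0 <= phi x <= 1) ->
  (forall x, K x -> phi x = 1) -> (forall x, ~ U x -> phi x = 0) ->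
  nu.-integrable setT (EFin \o (g : Borel T -> R)) ->
  `|\int[nu]_x (phi x * g x) - \int[nu]_(x in A) g x|
    <= \int[nu]_(x in U `\` K) `|g x|.
Proof.
move=> mK mA mU KA AU mphi phi01 phi1 phi0 ig.
have mUK : measurable (U `\` K) by exact: measurableD.
have phiM x : `|phi x| <= 1.
  by have /andP[p0 p1] := phi01 x; rewrite ger0_norm.
have iphig := bounded_mul_integrable mphi phiM ig.
have mi (B : set (Borel T)) : measurable B ->
    measurable_fun setT (\1_B : Borel T -> R).
  by move=> mB; exact: measurable_indic.
have iM (B : set (Borel T)) (x : T) : `|\1_B x : R| <= 1.
  by rewrite indicE; case: (_ \in _); rewrite ?normr0 ?normr1 ?ler01.
have iAg := bounded_mul_integrable (mi _ mA) (iM A) ig.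
have iUKg := bounded_mul_integrable (mi _ mUK) (iM (U `\` K)) (integrable_norm ig).
have mkc (B : set (Borel T)) (h : T -> R) :
    \int[nu]_(x in B) h x = \int[nu]_x (\1_B x * h x).
  rewrite Rintegral_mkcond; apply: eq_Rintegral => x _.
  by rewrite patchE indicE; case: (x \in B); rewrite ?mul1r ?mul0r.
rewrite (mkc A) (mkc (U `\` K)) -(RintegralB measurableT iphig iAg).
have iB := integrable_EFinB iphig iAg.
apply: (le_trans (le_normr_Rintegral _ iB)) => //.
apply: le_Rintegral => //; first exact: (integrable_norm iB).
move=> x _; rewrite -mulrBl normrM ler_wpM2r// !indicE.
have /andP[p0 p1] := phi01 x.
have [Kx|nKx] := pselect (K x).
  by rewrite phi1// (mem_set (KA _ Kx)) subrr normr0 ler0n.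
have [Ux|nUx] := pselect (U x); last first.
  rewrite phi0// memNset; last by move=> /AU.
  by rewrite subrr normr0 ler0n.
rewrite [in leRHS]mem_set// ler_norml; case: (_ \in _) => /=;
  by apply/andP; split; rewrite ?subr0; lra.
Qed.

(** Urysohn functions for one pair [K], [U] common to the three measures approximate the indicator
    of [A]. Besides the final density, this yields right invariance (with [g] zero) and almost
    everywhere equalities (with [mu1] equal to [mu2]). *)
Lemma regular_eq_density (m mu1 mu2 : {finite_measure set (Borel T) -> \bar R})
    (g : T -> R) :
  hausdorff_space T -> compact [set: T] ->
  regular_measure m -> regular_measure mu1 -> regular_measure mu2 ->
  m.-integrable setT (EFin \o (g : Borel T -> R)) ->
  (forall phi : T -> R, continuous phi -> (forall x, 0 <= phi x <= 1) ->
    \int[mu1]_(x in [set: Borel T]) phi x - \int[mu2]_(x in [set: Borel T]) phi x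
    = \int[m]_(x in [set: Borel T]) (phi x * g x)) ->
  forall A : set (Borel T), measurable A ->
    fine (mu1 A) - fine (mu2 A) = \int[m]_(x in A) g x.
Proof.
move=> hT cT rm r1 r2 ig H A mA.
have key (eps : R) : 0 < eps ->
    `|fine (mu1 A) - fine (mu2 A) - \int[m]_(x in A) g x| <= eps.
  move=> e0; have e30 : 0 < eps / 3 by rewrite divr_gt0.
  (* Absolute continuity of the integral: the gap must be small for [m] in terms of [dl], so that
     the integral of the absolute value of [g] over it is below [eps / 3]. *)
  have [dl [dl0 gdl]] := integral_normr_continuous ig e30.
  have [K1 [U1 [cK1 oU1 KA1 AU1 UK1]]] := r1 _ _ mA e30.
  have [K2 [U2 [cK2 oU2 KA2 AU2 UK2]]] := r2 _ _ mA e30.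
  have [K3 [U3 [cK3 oU3 KA3 AU3 UK3]]] := rm _ _ mA dl0.
  pose K := K1 `|` K2 `|` K3; pose U := U1 `&` U2 `&` U3.
  have cK : compact K by do 2 (apply: compactU => //).
  have oU : open U by do 2 (apply: openI => //).
  have KA : K `<=` A by move=> x [[/KA1//|/KA2//]|/KA3//].
  have AU : A `<=` U by move=> x Ax; split; [split; [exact: AU1|exact: AU2]|exact: AU3].
  have mc (C : set T) : compact C -> measurable (C : set (Borel T)).
    by move=> cC; apply: closed_Borel; exact: compact_closed.
  have mK : measurable (K : set (Borel T)) by exact: mc.
  have mU : measurable (U : set (Borel T)) by exact: open_Borel.
  have sub (nu : {finite_measure set (Borel T) -> \bar R}) (L V : set T) r :
      compact L -> open V -> L `<=` K -> U `<=` V ->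
      (nu (V `\` L) < r%:E)%E -> (nu (U `\` K) < r%:E)%E.
    move=> cL oV LK UV; apply: le_lt_trans; apply: le_measure; rewrite ?inE.
    - exact: measurableD.
    - by apply: measurableD; [exact: open_Borel|exact: mc].
    - by move=> x [/UV Vx nK]; split => // /LK.
  have {}UK1 := sub _ _ _ _ cK1 oU1
    (fun x h => or_introl (or_introl h)) (fun x h => h.1.1) UK1.
  have {}UK2 := sub _ _ _ _ cK2 oU2
    (fun x h => or_introl (or_intror h)) (fun x h => h.1.2) UK2.
  have {}UK3 := sub _ _ _ _ cK3 oU3
    (fun x h => or_intror h) (fun x h => h.2) UK3.
  have /(@uniform_separatorP _ R)[phi [cphi phi01 phi0 phi1]] :
      uniform_separator (~` U) K.
    apply: (((@normal_separatorP R T).1 (compact_normal hT cT))).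
    - exact: open_closedC.
    - exact: compact_closed.
    - by apply/disjoints_subset; apply: subsetC; exact: subset_trans KA AU.
  have {}phi01 x : 0 <= phi x <= 1.
    by have := phi01 (phi x) (ex_intro2 _ _ x I erefl); rewrite /= in_itv.
  have {}phi1 x : K x -> phi x = 1 by move=> Kx; apply: phi1; exists x.
  have {}phi0 x : ~ U x -> phi x = 0 by move=> Ux; apply: phi0; exists x.
  have mphi := continuous_Borel cphi.
  have one (nu : {finite_measure set (Borel T) -> \bar R}) r :
      (nu (U `\` K) < r%:E)%E -> `|\int[nu]_x phi x - fine (nu A)| <= r.
    move=> UKr.
    have i1 : nu.-integrable setT (EFin \o (cst 1 : Borel T -> R)).
      by apply: (@bounded_integrable _ _ _ _ _ 1) => // x; rewrite normr1.
    have := sandwich_Rintegral mK mA mU KA AU mphi phi01 phi1 phi0 i1.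
    rewrite Rintegral_cst// mul1r.
    under eq_Rintegral do rewrite mulr1.
    move=> /le_trans; apply.
    under eq_Rintegral do rewrite normr1.
    rewrite Rintegral_cst ?mul1r; last exact: measurableD.
    rewrite -lee_fin fineK; last by rewrite fin_num_measure//; exact: measurableD.
    exact: ltW.
  have := one _ _ UK1; have := one _ _ UK2.
  have := sandwich_Rintegral mK mA mU KA AU mphi phi01 phi1 phi0 ig.
  have /ltW := gdl _ (measurableD mU mK) UK3.
  move=> /[swap] /le_trans /[apply].
  rewrite -(H _ cphi phi01).
  rewrite !ler_norml => /andP[? ?] /andP[? ?] /andP[? ?].
  by apply/andP; split; lra.
apply/eqP; rewrite -subr_eq0 -normr_eq0 eq_le normr_ge0 andbT.
by apply/ler_addgt0Pr => eps /key; rewrite add0r.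
Qed.

End regular.

(** * Fubini for continuous kernels *)

Section fubini.
Context {R : realType} {T : ptopologicalType}.

Lemma open_rectangle (U V : set T) : open U -> open V -> open (U `*` V).
Proof.
move=> oU oV; rewrite openE => -[a b] [/= Ua Vb].
by exists (U, V) => //; split; exact: open_nbhs_nbhs.
Qed.

(** A base point is packed into the product so that [compact_cover] applies. *)
Lemma compact_cover_prod : @compact (T * T)%type `<=` @cover_compact (T * T)%type.
Proof.
pose pp := isPointed.Build (T * T)%type (point, point).
pose TT : ptopologicalType := HB.pack (T * T)%type pp.
by have := @compact_cover TT => ->.
Qed.

(** Finitely many open rectangles inside [O] cover [C]. Their union lies in the product
    sigma-algebra, whereas [O] itself may not. *)
Lemma compact_open_measurable_between (C O : set (T * T)) :
  compact C -> open O -> C `<=` O ->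
  exists M : set (Borel T * Borel T), [/\ measurable M, C `<=` M & M `<=` O].
Proof.
move=> cC oO CO.
have nbh (p : T * T) : exists UV : set T * set T, C p ->
    [/\ open UV.1, open UV.2, UV.1 p.1, UV.2 p.2 & UV.1 `*` UV.2 `<=` O].
  have [Cp|nCp] := pselect (C p); last by exists (set0, set0).
  have : nbhs p O by apply: open_nbhs_nbhs; split => //; exact: CO.
  move=> [[P Q] [/= nP nQ] PQO].
  move: nP nQ; rewrite !nbhsE => -[U [oU Up] UP] [V [oV Vp] VQ].
  exists (U, V) => _; split => //= q [/= /UP Pq /VQ Qq].
  exact: PQO.
have [f fP] := choice nbh.
have [D' D'C CD'] : finite_subset_cover C (fun p => (f p).1 `*` (f p).2) C.
  apply: compact_cover_prod => //.
  - by move=> p /fP [oU oV _ _ _]; apply: open_rectangle.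
  - by move=> p Cp; exists p => //; have [] := fP _ Cp.
exists (\bigcup_(i in [set` D']) ((f i).1 `*` (f i).2)); split => //.
- apply: fin_bigcup_measurable => // p pD'.
  have Cp : C p by have := D'C _ pD'; rewrite inE.
  have [oU oV _ _ _] := fP _ Cp.
  by apply: measurableX; exact: open_Borel.
- move=> q [p pD'].
  have Cp : C p by have := D'C _ pD'; rewrite inE.
  by have [_ _ _ _] := fP _ Cp; exact.
Qed.

(* The Borel sigma-algebra of [T * T] may be strictly larger than the product of
   the Borel sigma-algebras; a continuous function is nevertheless measurable
   for the latter, because each [K > c] is a countable union of compact sets. *)
Lemma continuous_measurable_prod (K : T * T -> R) :
  compact [set: T] -> continuous K ->
  measurable_fun setT (K : Borel T * Borel T -> R).
Proof.
move=> cT cK; apply: (measurability _ (RGenOInfty.measurableE R)) => //.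
move=> _ [_ [c ->]] <-; rewrite setTI.
have key n : exists M : set (Borel T * Borel T), [/\ measurable M,
    [set p | c + n.+1%:R^-1 <= K p] `<=` M & M `<=` [set p | c < K p]].
  apply: compact_open_measurable_between.
  - rewrite -[X in compact X]setTI; apply: compact_closedI.
      by rewrite -setXTT; exact: compact_setX.
    by apply: (@closed_comp _ _ K [set y | c + n.+1%:R^-1 <= y]) => [p _|];
      [exact: cK|exact: closed_ge].
  - by apply: (@open_comp _ _ K [set y | c < y]) => [p _|];
      [exact: cK|exact: open_gt].
  - by move=> p /=; apply: lt_le_trans; rewrite ltrDl invr_gt0.
have [M MP] := choice key.
rewrite (_ : _ @^-1` _ = \bigcup_n M n).
  by apply: bigcupT_measurable => n; have [] := MP n.
apply/seteqP; split => [p /=|p [n _ Mnp]]; rewrite /= in_itv/= andbT; last first.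
  by have [_ _ /(_ _ Mnp)] := MP n.
move=> cKp; have [n _ cn] : exists2 n, True & n.+1%:R^-1 < K p - c.
  exists (Num.truncn (K p - c)^-1) => //.
  have Kc : 0 < K p - c by rewrite subr_gt0.
  by rewrite invf_plt ?posrE// truncnS_gt.
by exists n => //; have [_ + _] := MP n; apply; rewrite /= -lerBrDl; exact: ltW.
Qed.

Lemma continuous_Fubini (m1 m2 : {finite_measure set (Borel T) -> \bar R})
    (K : T -> T -> R) :
  compact [set: T] -> continuous (fun p : T * T => K p.1 p.2) ->
  \int[m1]_(x in [set: Borel T]) \int[m2]_(y in [set: Borel T]) K x y
  = \int[m2]_(y in [set: Borel T]) \int[m1]_(x in [set: Borel T]) K x y.
Proof.
move=> cT cK.
have cTT : compact [set: T * T] by rewrite -setXTT; exact: compact_setX.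
have [M M0 KM] := compact_continuous_bounded cTT cK.
have mK := continuous_measurable_prod cT cK.
have cr x : continuous (K x).
  move=> y; apply: (@continuous_comp _ _ _ (pair x) (fun p => K p.1 p.2)).
    by apply: cvg_pair => //; exact: cvg_cst.
  exact: cK.
have cl y : continuous (K ^~ y).
  move=> x; apply: (@continuous_comp _ _ _ (pair ^~ y) (fun p => K p.1 p.2)).
    by apply: cvg_pair => //; exact: cvg_cst.
  exact: cK.
have iK : (m1 \x m2)%E.-integrable setT
    (EFin \o (fun p : Borel T * Borel T => K p.1 p.2)).
  apply: measurable_bounded_integrable => //.
    have /= mTT := product_measure1E m1 m2 measurableT measurableT.
    rewrite setXTT in mTT; rewrite mTT.
    by rewrite ltey_eq fin_numM// fin_num_measure.
  exists M; split => [|y My x _]; first exact: num_real.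
  by apply: le_trans (KM x) _; exact: ltW.
have := Fubini iK; rewrite /Rintegral => F.
congr fine; transitivity (\int[m1]_x \int[m2]_y (K x y)%:E)%E.
  apply: eq_integral => x _; rewrite fineK//.
  by apply: integrable_fin_num => //; exact: continuous_integrable.
transitivity (\int[m2]_y \int[m1]_x (K x y)%:E)%E => //.
apply: eq_integral => y _; rewrite fineK//.
by apply: integrable_fin_num => //; exact: continuous_integrable.
Qed.

End fubini.

(** * Compact groups *)

Lemma open_of_nbhs (X : topologicalType) (A : set X) :
  (forall x, A x -> nbhs x A) -> open A.
Proof. by rewrite openE. Qed.

(** * Integrals and measures depending on a parameter *)

Section parametric_integral.
Context {R : realType} {T : ptopologicalType}.
Implicit Types mu : {finite_measure set (Borel T) -> \bar R}.

Lemma integral_continuous mu (K : T -> T -> R) :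
  compact [set: T] -> continuous (fun p : T * T => K p.1 p.2) ->
  continuous (fun x => \int[mu]_(s in [set: Borel T]) K s x).
Proof.
move=> cT cK x0.
have cl y : continuous (K ^~ y).
  move=> x; apply: (@continuous_comp _ _ _ (pair ^~ y) (fun p => K p.1 p.2)).
    by apply: cvg_pair => //; exact: cvg_cst.
  exact: cK.
apply/cvgrPdist_le => eps e0.
(* The added 1 keeps the divisor positive when [mu] is zero. *)
pose c := fine (mu setT) + 1.
have c0 : 0 < c by rewrite ltr_wpDl// fine_ge0.
pose del := eps / c; have d0 : 0 < del by rewrite divr_gt0.
(* Tube argument: compactness in [s] makes the neighbourhood of [x0] uniform. *)
have unif : \forall x \near x0, [set: T] `<=` (fun s => `|K s x0 - K s x| < del).
  move/compact_near_coveringP : cT; apply => s _.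
  have d20 : 0 < del / 2 by rewrite divr_gt0.
  have /cvgrPdist_lt/(_ _ d20) := cK (s, x0).
  move=> [[P Q] [/= nP nQ] PQ].
  exists (P, Q) => // -[s' x] [/= Ps' Qx].
  have h1 := PQ (s', x) (conj Ps' Qx).
  have h2 := PQ (s', x0) (conj Ps' (nbhs_singleton nQ)).
  rewrite /= in h1 h2.
  rewrite -(subrKA (K s x0)) (le_lt_trans (ler_normD _ _))//.
  by rewrite [ltRHS]splitr distrC ltrD.
apply: filterS unif => x /= ux.
have i1 := continuous_integrable mu cT (cl x0).
have i2 := continuous_integrable mu cT (cl x).
rewrite -(RintegralB measurableT i1 i2).
have iB := integrable_EFinB i1 i2.
apply: (le_trans (le_normr_Rintegral _ iB)) => //.
apply: (@le_trans _ _ (\int[mu]_(s in [set: Borel T]) del)).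
  apply: le_Rintegral => //; first exact: (integrable_norm iB).
    by apply: (@bounded_integrable _ _ _ _ _ `|del|).
  by move=> s _; apply: ltW; exact: ux.
rewrite Rintegral_cst// /del mulrAC ler_pdivrMr// ler_pM2l// /c.
by rewrite lerDl.
Qed.

(** Lower semicontinuity: a compact subset of the section at [t0] with almost full measure stays, by
    the tube argument, inside the sections at nearby [t]. This replaces the product measurability of
    [U], which may fail. *)
Lemma regular_open_section mu (U : set (T * T)) :
  hausdorff_space T -> regular_measure mu -> open U ->
  measurable_fun setT (fun t : Borel T => fine (mu [set s : T | U (s, t)])).
Proof.
move=> hT rmu oU.
have oS t : open [set s : T | U (s, t)].
  apply: (@open_comp _ _ (pair ^~ t) U) => // s _.
  by apply: cvg_pair => //; exact: cvg_cst.
have mS t := open_Borel (oS t).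
apply: (measurability _ (RGenOInfty.measurableE R)) => //.
move=> _ [_ [a ->]] <-; rewrite setTI; apply: open_Borel.
apply: open_of_nbhs => t0 /=; rewrite in_itv/= andbT => at0.
have d0 : 0 < fine (mu [set s | U (s, t0)]) - a by rewrite subr_gt0.
have [K [V [cK oV KS SV VK]]] := rmu _ _ (mS t0) d0.
have unif : \forall t \near t0, K `<=` (fun s => U (s, t)).
  move/compact_near_coveringP : cK; apply => s Ks.
  have : nbhs (s, t0) U by apply: open_nbhs_nbhs; split => //; exact: KS.
  by move=> [[P Q] [/= nP nQ] PQ]; exists (P, Q) => // -[s' x] PQx; exact: PQ.
apply: filterS unif => t /= Kt.
rewrite in_itv/= andbT.
have mK : measurable (K : set (Borel T)).
  by apply: closed_Borel; exact: compact_closed.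
have mV : measurable (V : set (Borel T)) by exact: open_Borel.
have mVK := measurableD mV mK.
have leK : (mu K <= mu [set s | U (s, t)])%E by apply: le_measure; rewrite ?inE.
have : (mu [set s | U (s, t0)] <= mu K + mu (V `\` K))%E.
  apply: (le_trans _ (measureU2 _ mK mVK)).
  apply: le_measure; rewrite ?inE//; first exact: measurableU.
  by move=> s /SV Vs; have [Ks|nKs] := pselect (K s); [left|right].
have fineE (B : set (Borel T)) : measurable B -> mu B = (fine (mu B))%:E.
  by move=> mB; rewrite fineK// fin_num_measure.
move: VK leK.
rewrite (fineE _ mVK) (fineE _ mK) (fineE _ (mS t)) (fineE _ (mS t0)).
rewrite -EFinD !lee_fin lte_fin.
rewrite /=; move: (fine (mu [set s | U (s, t)]))
  (fine (mu [set s | U (s, t0)])) (fine (mu K)) (fine (mu (V `\` K))).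
by move=> x1 x2 x3 x4; clear; lra.
Qed.

End parametric_integral.

(** * Group identities and invariance of Haar measure *)

Section group.
Context {R : realType} {T : ptopologicalType} (mul : T -> T -> T) (inv : T -> T)
  (e : T) (tg : topological_group mul inv e).

Lemma tg_mulA : associative mul. Proof. by case: tg. Qed.
Lemma tg_mul1g : left_id e mul. Proof. by case: tg. Qed.
Lemma tg_mulVg : left_inverse e inv mul. Proof. by case: tg. Qed.
Lemma tg_mulgV x : mul x (inv x) = e.
Proof.
by rewrite -[LHS]tg_mul1g -(tg_mulVg (inv x)) -tg_mulA (tg_mulA (inv x))
  tg_mulVg tg_mul1g tg_mulVg.
Qed.
Lemma tg_mulg1 x : mul x e = x.
Proof. by rewrite -(tg_mulVg x) tg_mulA tg_mulgV tg_mul1g. Qed.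
Lemma tg_mulKg x : cancel (mul x) (mul (inv x)).
Proof. by move=> y; rewrite tg_mulA tg_mulVg tg_mul1g. Qed.
Lemma tg_mulVKg x : cancel (mul (inv x)) (mul x).
Proof. by move=> y; rewrite tg_mulA tg_mulgV tg_mul1g. Qed.
Lemma tg_mulgK x : cancel (mul ^~ x) (mul ^~ (inv x)).
Proof. by move=> y; rewrite -tg_mulA tg_mulgV tg_mulg1. Qed.
Lemma tg_mulgVK x : cancel (mul ^~ (inv x)) (mul ^~ x).
Proof. by move=> y; rewrite -tg_mulA tg_mulVg tg_mulg1. Qed.
Lemma tg_invK : involutive inv.
Proof. by move=> x; rewrite -[LHS]tg_mulg1 -(tg_mulVg x) tg_mulKg. Qed.
Lemma tg_invM x y : inv (mul x y) = mul (inv y) (inv x).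
Proof.
have h : mul (mul x y) (mul (inv y) (inv x)) = e.
  by rewrite tg_mulA tg_mulgK tg_mulgV.
by rewrite -[LHS]tg_mulg1 -h tg_mulKg.
Qed.

Lemma continuous_mul : continuous (fun p : T * T => mul p.1 p.2).
Proof. by case: tg. Qed.
Lemma continuous_inv : continuous inv. Proof. by case: tg. Qed.
Lemma continuous_mull x : continuous (mul x).
Proof.
move=> y; apply: (@continuous_comp _ _ _ (pair x) (fun p => mul p.1 p.2)).
  by apply: cvg_pair => //; exact: cvg_cst.
exact: continuous_mul.
Qed.
Lemma continuous_mulr x : continuous (mul ^~ x).
Proof.
move=> y; apply: (@continuous_comp _ _ _ (pair ^~ x) (fun p => mul p.1 p.2)).
  by apply: cvg_pair => //; exact: cvg_cst.
exact: continuous_mul.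
Qed.
Lemma continuous_divl : continuous (fun p : T * T => mul (inv p.1) p.2).
Proof.
move=> p; apply: (@continuous_comp _ _ _ (fun p => (inv p.1, p.2))
  (fun p => mul p.1 p.2)); last exact: continuous_mul.
apply: cvg_pair; last exact: cvg_snd.
apply: (@continuous_comp _ _ _ fst inv); first exact: cvg_fst.
exact: continuous_inv.
Qed.

Context (hT : hausdorff_space T) (cT : compact [set: T])
  (m : {finite_measure set (Borel T) -> \bar R})
  (mT : m [set: T] = 1%E) (rm : regular_measure m)
  (linv : forall (x : T) (A : set (Borel T)), measurable A ->
    m (mul x @` A) = m A).

Lemma Rintegral_left_invariant (h : T -> R) x : continuous h ->
  \int[m]_(t in [set: Borel T]) h (mul x t) = \int[m]_(t in [set: Borel T]) h t.
Proof.
move=> ch.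
have mf := continuous_Borel_Borel (@continuous_mull x).
rewrite /Rintegral; congr fine.
transitivity (\int[pushforward m (mul x : Borel T -> Borel T)]_t (h t)%:E)%E.
  rewrite (integral_pushforward mf (mu := m) (f := EFin \o (h : Borel T -> R)))//.
  - by apply/measurable_EFinP; exact: continuous_Borel.
  - rewrite preimage_setT; apply: (continuous_integrable m cT) => t.
    by apply: continuous_comp; [exact: continuous_mull|exact: ch].
apply: eq_measure_integral => A mA _ /=.
(* Invariance is given for images: the preimage of [A] under [mul x] is its image under
   [mul (inv x)]. *)
rewrite /pushforward -(linv (inv x) mA); congr (m _).
apply/seteqP; split => [t /= xt|_ /= [t At <-]]; last by rewrite /= tg_mulVKg.
by exists (mul x t) => //; rewrite tg_mulKg.
Qed.

(* Integrate [h (s^-1 t)] over [s] and [t] in both orders. *)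
Lemma Rintegral_inv (h : T -> R) : continuous h ->
  \int[m]_(t in [set: Borel T]) h (inv t) = \int[m]_(t in [set: Borel T]) h t.
Proof.
move=> ch.
have cih : continuous (fun t => h (inv t)).
  by move=> t; apply: continuous_comp; [exact: continuous_inv|exact: ch].
have cdh : continuous (fun p : T * T => h (mul (inv p.1) p.2)).
  by move=> t; apply: continuous_comp; [exact: continuous_divl|exact: ch].
have cst1 (c : R) : c = \int[m]_(t in [set: Borel T]) c.
  by rewrite Rintegral_cst// [X in fine X]mT mulr1.
rewrite [RHS]cst1 [LHS]cst1.
transitivity (\int[m]_(t in [set: Borel T]) \int[m]_(s in [set: Borel T])
    h (mul (inv s) t)).
  apply: eq_Rintegral => t _; rewrite -(Rintegral_left_invariant (inv t) cih).
  by apply: eq_Rintegral => s _; rewrite tg_invM tg_invK.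
rewrite (continuous_Fubini m m (K := fun t s => h (mul (inv s) t)))//; last first.
  move=> p; apply: (@continuous_comp _ _ _ (fun p : T * T => (p.2, p.1))
    (fun p : T * T => h (mul (inv p.1) p.2))); last exact: cdh.
  by apply: cvg_pair; [exact: cvg_snd|exact: cvg_fst].
by apply: eq_Rintegral => s _; rewrite Rintegral_left_invariant.
Qed.

(** Inversion exchanges right and left translations: t^-1 y is the inverse of y^-1 t. *)
Lemma Rintegral_right_invariant (h : T -> R) y : continuous h ->
  \int[m]_(t in [set: Borel T]) h (mul t y) = \int[m]_(t in [set: Borel T]) h t.
Proof.
move=> ch.
have cih : continuous (fun t => h (inv t)).
  by move=> t; apply: continuous_comp; [exact: continuous_inv|exact: ch].
have chy : continuous (fun t => h (mul t y)).
  by move=> t; apply: continuous_comp; [exact: continuous_mulr|exact: ch].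
rewrite -(Rintegral_inv chy) -(Rintegral_inv ch).
rewrite -(Rintegral_left_invariant (inv y) cih).
by apply: eq_Rintegral => s _; rewrite tg_invM tg_invK.
Qed.

(** The push-forward is regular, since translations are homeomorphisms, and it agrees with [m] on
    continuous functions; [regular_eq_density] with density zero passes to Borel sets. *)
Lemma measure_right_invariant y (A : set (Borel T)) : measurable A ->
  pushforward m (mul ^~ y : Borel T -> Borel T) A = m A.
Proof.
move=> mA.
have mf := continuous_Borel_Borel (@continuous_mulr y).
have [nu nuE] := pushforward_finite_measure m mf.
have rnu : regular_measure nu.
  rewrite nuE; apply: (pushforward_regular (g := mul ^~ (inv y))) => //.
  - exact: continuous_mulr.
  - exact: continuous_mulr.
  - exact: tg_mulgVK.
  - exact: tg_mulgK.
have i0 : m.-integrable setT (EFin \o (cst 0 : Borel T -> R)).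
  by apply: (@bounded_integrable _ _ _ _ _ 0) => // x; rewrite normr0.
have := regular_eq_density hT cT rm rnu rm i0.
have H (phi : T -> R) : continuous phi -> (forall x, 0 <= phi x <= 1) ->
    \int[nu]_(x in [set: Borel T]) phi x - \int[m]_(x in [set: Borel T]) phi x
    = \int[m]_(x in [set: Borel T]) (phi x * cst 0 x).
  move=> cphi _.
  under [RHS]eq_Rintegral do rewrite mulr0.
  rewrite Rintegral_cst// mul0r.
  apply/eqP; rewrite subr_eq0; apply/eqP.
  rewrite -(Rintegral_right_invariant y cphi) /Rintegral; congr fine.
  transitivity (\int[pushforward m (mul ^~ y : Borel T -> Borel T)]_t (phi t)%:E)%E.
    apply: eq_measure_integral => B mB _.
    exact: (congr1 (fun n => n B) nuE).
  rewrite (integral_pushforward mf (mu := m) (f := EFin \o (phi : Borel T -> R)))//.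
  - by apply/measurable_EFinP; exact: continuous_Borel.
  - rewrite preimage_setT; apply: (continuous_integrable m cT) => t.
    by apply: continuous_comp; [exact: continuous_mulr|exact: cphi].
move=> /(_ H A mA); rewrite Rintegral_cst// mul0r.
move=> /eqP; rewrite subr_eq0 => /eqP.
have -> : pushforward m (mul ^~ y : Borel T -> Borel T) A = nu A by rewrite nuE.
move=> h; rewrite -[LHS]fineK ?fin_num_measure// -[RHS]fineK ?fin_num_measure//.
by rewrite h.
Qed.

End group.

(** * Pairing convolutions with continuous functions *)

(** The sum counts the naturals below [y], which gives the ceiling of [y] as long as [y] is at most
    [n]. The saturated case is what carries the induction. *)
Lemma count_below (R : realType) (y : R) n : 0 <= y ->
  (y <= n%:R -> y <= \sum_(k < n) ((k%:R < y)%R%:R : R) <= y + 1) /\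
  (n%:R < y -> \sum_(k < n) ((k%:R < y)%R%:R : R) = n%:R).
Proof.
move=> y0; elim: n => [|n [ih1 ih2]].
  rewrite big_ord0; split => // y0'; apply/andP; split => //.
  by rewrite addr_ge0.
rewrite big_ord_recr/=; split => [yn|ny].
  have [ny|yn'] := ltP n%:R y; last by rewrite addr0; exact: ih1.
  rewrite ih2// mulr1n; rewrite -natr1 in yn.
  by apply/andP; split => //; rewrite lerD2r ltW.
have ny' : n%:R < y by apply: lt_trans ny; rewrite ltr_nat.
by rewrite ih2// ny' -natr1.
Qed.

(** By [count_below] at (n+1) h(x), the average of the level-set indicators is h(x) rounded up to a
    multiple of 1/(n+1). The strict inequality makes the level sets open when [h] is continuous. *)
Lemma level_set_approx (R : realType) (X : Type) (h : X -> R) n x :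
  0 <= h x <= 1 ->
  `|h x - n.+1%:R^-1 * \sum_(k < n.+1) \1_[set z | k%:R / n.+1%:R < h z] x|
    <= n.+1%:R^-1.
Proof.
move=> /andP[h0 h1].
have n0 : 0 < n.+1%:R :> R by [].
have y0 : 0 <= n.+1%:R * h x by rewrite mulr_ge0.
have yn : n.+1%:R * h x <= n.+1%:R by rewrite ger_pMr.
have [/(_ yn) + _] := count_below n.+1 y0.
rewrite (eq_bigr (fun k : 'I_n.+1 => \1_[set z | k%:R / n.+1%:R < h z] x)).
  move=> /andP[s1 s2].
  have e : h x = n.+1%:R^-1 * (n.+1%:R * h x) by rewrite mulKf.
  rewrite [X in `|X - _|]e -mulrBr normrM ger0_norm ?invr_ge0//.
  by rewrite -[leRHS]mulr1 ler_pM2l ?invr_gt0// ler_norml; apply/andP; split; lra.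
move=> k _; rewrite indicE; congr (_%:R).
have -> : (x \in [set z | k%:R / n.+1%:R < h z]) = (k%:R / n.+1%:R < h x).
  by apply/idP/idP; rewrite inE.
by rewrite ltr_pdivrMr// mulrC.
Qed.

Section key_identity.
Context {R : realType} {T : ptopologicalType} (mul : T -> T -> T) (inv : T -> T)
  (e : T) (tg : topological_group mul inv e).
Context (hT : hausdorff_space T) (cT : compact [set: T])
  (m : {finite_measure set (Borel T) -> \bar R})
  (rm : regular_measure m)
  (linv : forall (x : T) (A : set (Borel T)), measurable A ->
    m (mul x @` A) = m A).

Lemma indic_Rintegral (mu : {finite_measure set (Borel T) -> \bar R})
    (A : set (Borel T)) : measurable A ->
  \int[mu]_(s in [set: Borel T]) \1_A s = fine (mu A).
Proof. by move=> mA; rewrite /Rintegral integral_indic// setIT. Qed.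

(** For fixed [s], left invariance allows the substitution t = s x; Fubini is applied before it and
    after it. *)
Lemma convolution_pairing (mu : {finite_measure set (Borel T) -> \bar R})
    (phi h : T -> R) : continuous phi -> continuous h ->
  \int[m]_(t in [set: Borel T])
    (phi t * \int[mu]_(s in [set: Borel T]) h (mul (inv s) t))
  = \int[m]_(x in [set: Borel T])
    (h x * \int[mu]_(s in [set: Borel T]) phi (mul s x)).
Proof.
move=> cphi ch.
have cdh : continuous (fun p : T * T => h (mul (inv p.1) p.2)).
  by move=> t; apply: continuous_comp; [exact: (continuous_divl tg)|exact: ch].
have cmp : continuous (fun p : T * T => phi (mul p.1 p.2)).
  by move=> t; apply: continuous_comp; [exact: (continuous_mul tg)|exact: cphi].
have cpair (f : T * T -> R) t : continuous f -> continuous (fun s => f (s, t)).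
  move=> cf s; apply: (@continuous_comp _ _ _ (pair ^~ t) f); last exact: cf.
  by apply: cvg_pair => //; exact: cvg_cst.
have cpair' (f : T * T -> R) s : continuous f -> continuous (fun t => f (s, t)).
  move=> cf t; apply: (@continuous_comp _ _ _ (pair s) f); last exact: cf.
  by apply: cvg_pair => //; exact: cvg_cst.
have cswap (f : T * T -> R) : continuous f -> continuous (fun p => f (p.2, p.1)).
  move=> cf p; apply: (@continuous_comp _ _ _ (fun p => (p.2, p.1)) f).
    by apply: cvg_pair; [exact: cvg_snd|exact: cvg_fst].
  exact: cf.
have c1 : continuous (fun p : T * T => phi p.2 * h (mul (inv p.1) p.2)).
  move=> p; apply: continuousM; last exact: cdh.
  by apply: continuous_comp; [exact: cvg_snd|exact: cphi].
have c2 : continuous (fun p : T * T => h p.2 * phi (mul p.1 p.2)).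
  move=> p; apply: continuousM; last exact: cmp.
  by apply: continuous_comp; [exact: cvg_snd|exact: ch].
transitivity (\int[m]_(t in [set: Borel T]) \int[mu]_(s in [set: Borel T])
    (phi t * h (mul (inv s) t))).
  apply: eq_Rintegral => t _; rewrite RintegralZl//.
  exact: (continuous_integrable mu cT (cpair _ t cdh)).
rewrite (continuous_Fubini m mu (K := fun t s => phi t * h (mul (inv s) t)))//;
  last exact: cswap c1.
transitivity (\int[mu]_(s in [set: Borel T]) \int[m]_(t in [set: Borel T])
    (h t * phi (mul s t))).
  apply: eq_Rintegral => s _.
  rewrite -(Rintegral_left_invariant tg cT linv s (cpair' _ s c1))/=.
  by apply: eq_Rintegral => t _; rewrite (tg_mulKg tg) mulrC.
rewrite (continuous_Fubini mu m (K := fun s t => h t * phi (mul s t)))//.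
apply: eq_Rintegral => t _; rewrite RintegralZl//.
exact: (continuous_integrable mu cT (cpair _ t cmp)).
Qed.

Context (mu1 mu2 : {finite_measure set (Borel T) -> \bar R})
  (r1 : regular_measure mu1) (r2 : regular_measure mu2).

(** Convolution of [h] with the signed measure mu1 - mu2; at indicators, one real component of
    [nu_mu]. *)
Definition conv_diff (h : T -> R) (t : T) : R :=
  \int[mu1]_(s in [set: Borel T]) h (mul (inv s) t)
  - \int[mu2]_(s in [set: Borel T]) h (mul (inv s) t).

(** Pairing of [phi] with the image of mu1 - mu2 under right translation by [x]. *)
Definition translate_diff (phi : T -> R) (x : T) : R :=
  \int[mu1]_(s in [set: Borel T]) phi (mul s x)
  - \int[mu2]_(s in [set: Borel T]) phi (mul s x).

Let open_translate (U : set T) t : open U -> open [set s | U (mul (inv s) t)].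
Proof.
move=> oU; apply: (@open_comp _ _ (fun s => mul (inv s) t) U) => // s _.
apply: (@continuous_comp _ _ _ (pair ^~ t) (fun p => mul (inv p.1) p.2)).
  by apply: cvg_pair => //; exact: cvg_cst.
exact: (continuous_divl tg).
Qed.

Let indic_translateE (mu : {finite_measure set (Borel T) -> \bar R})
    (U : set T) t : open U ->
  \int[mu]_(s in [set: Borel T]) (\1_U (mul (inv s) t) : R)
  = fine (mu [set s | U (mul (inv s) t)]).
Proof.
move=> oU; rewrite -indic_Rintegral; last first.
  by apply: open_Borel; exact: open_translate.
by apply: eq_Rintegral => s _; rewrite !indicE.
Qed.

Lemma measurable_translate_open (mu : {finite_measure set (Borel T) -> \bar R})
    (U : set T) : regular_measure mu -> open U ->
  measurable_fun setT (fun t : Borel T =>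
    \int[mu]_(s in [set: Borel T]) (\1_U (mul (inv s) t) : R)).
Proof.
move=> rmu oU.
under eq_fun do rewrite indic_translateE//.
apply: (regular_open_section hT rmu (U := [set p | U (mul (inv p.1) p.2)])).
apply: (@open_comp _ _ (fun p : T * T => mul (inv p.1) p.2) U) => // p _.
exact: (continuous_divl tg).
Qed.

Lemma measurable_conv_open (U : set T) : open U ->
  measurable_fun setT (conv_diff \1_U : Borel T -> R).
Proof.
move=> oU; apply: measurable_funB; exact: measurable_translate_open.
Qed.

Let norm_Rintegral_le (mu : {finite_measure set (Borel T) -> \bar R})
    (f : T -> R) (c : R) : mu.-integrable setT (EFin \o (f : Borel T -> R)) ->
  (forall x, `|f x| <= c) ->
  `|\int[mu]_(s in [set: Borel T]) f s| <= c * fine (mu setT).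
Proof.
move=> fi fc; apply: (le_trans (le_normr_Rintegral _ fi)) => //.
rewrite -Rintegral_cst//; apply: le_Rintegral => //.
- exact: (integrable_norm fi).
- by apply: (@bounded_integrable _ _ _ _ _ `|c|).
Qed.

Let total : R := fine (mu1 setT) + fine (mu2 setT).

Let conv_diff_le (f : T -> R) t (c : R) :
  measurable_fun setT (fun s : Borel T => f (mul (inv s) t)) ->
  (forall x, `|f x| <= c) -> `|conv_diff f t| <= c * total.
Proof.
move=> mf fc; apply: (le_trans (ler_normB _ _)); rewrite mulrDr.
by apply: lerD; apply: norm_Rintegral_le => //;
  exact: (bounded_integrable _ mf).
Qed.

Lemma conv_diff_open_integrable (U : set T) : open U ->
  m.-integrable setT (EFin \o (conv_diff \1_U : Borel T -> R)).
Proof.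
move=> oU; apply: (@bounded_integrable _ _ _ _ _ (1 * total)).
  exact: measurable_conv_open.
move=> t; apply: conv_diff_le.
  rewrite (_ : (fun s => _) = \1_[set s | U (mul (inv s) t)]).
    by apply: measurable_indic; apply: open_Borel; exact: open_translate.
  by apply/funext => s; rewrite !indicE.
by move=> x; rewrite indicE; case: (_ \in _); rewrite ?normr1 ?normr0.
Qed.

(* Only indicators of open sets are allowed in the hypothesis: for them the
   convolution is semicontinuous, hence measurable. *)
Lemma pairing_open_continuous (phi g : T -> R) : continuous phi ->
  m.-integrable setT (EFin \o (g : Borel T -> R)) ->
  (forall U : set T, open U ->
    \int[m]_(x in (U : set (Borel T))) g x
    = \int[m]_(t in [set: Borel T]) (phi t * conv_diff \1_U t)) ->
  forall h : T -> R, continuous h -> (forall x, 0 <= h x <= 1) ->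
    \int[m]_(x in [set: Borel T]) (h x * g x)
    = \int[m]_(t in [set: Borel T]) (phi t * conv_diff h t).
Proof.
move=> cphi ig H h ch h01.
have [M M0 phiM] := compact_continuous_bounded cT cphi.
have mphi := continuous_Borel cphi.
have mh := continuous_Borel ch.
have hM x : `|h x| <= 1 by have /andP[? ?] := h01 x; rewrite ger0_norm.
have ihg := bounded_mul_integrable mh hM ig.
have ctr t : continuous (fun s => h (mul (inv s) t)).
  move=> s; apply: (@continuous_comp _ _ _ (fun s => mul (inv s) t) h);
    last exact: ch.
  apply: (@continuous_comp _ _ _ (pair ^~ t) (fun p => mul (inv p.1) p.2)).
    by apply: cvg_pair => //; exact: cvg_cst.
  exact: (continuous_divl tg).
have cconvh : continuous (conv_diff h).
  have cdh : continuous (fun p : T * T => h (mul (inv p.1) p.2)).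
    by move=> p; apply: continuous_comp; [exact: (continuous_divl tg)|exact: ch].
  have ci (mu : {finite_measure set (Borel T) -> \bar R}) :=
    @integral_continuous _ _ mu (fun s t => h (mul (inv s) t)) cT cdh.
  by move=> t; apply: cvgB; exact: ci.
have iphic : m.-integrable setT
    (EFin \o (fun t : Borel T => phi t * conv_diff h t)).
  by apply: (continuous_integrable m cT) => t;
    apply: continuousM; [exact: cphi|exact: cconvh].
(* Replacing [h] by a function at uniform distance 1/(n+1) costs the first summand, divided by n+1,
   on the left and the second one on the right. *)
pose C := \int[m]_(x in [set: Borel T]) `|g x| + M * (total * fine (m setT)).
suff key n : `|\int[m]_(x in [set: Borel T]) (h x * g x)
    - \int[m]_(t in [set: Borel T]) (phi t * conv_diff h t)| <= n.+1%:R^-1 * C.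
  apply/eqP; rewrite -subr_eq0 -normr_eq0 eq_le normr_ge0 andbT.
  apply/ler_addgt0Pr => eps e0; rewrite add0r.
  apply: (le_trans (key (Num.truncn (C / eps)))).
  by rewrite mulrC ler_pdivrMr// mulrC -ler_pdivrMr// ltW// truncnS_gt.
pose U k : set T := [set z | k%:R / n.+1%:R < h z].
have oU k : open (U k).
  by apply: (@open_comp _ _ h [set y | k%:R / n.+1%:R < y]) => [p _|];
    [exact: ch|exact: open_gt].
(* A finite combination of indicators of open sets, for which the identity follows from [H] by
   linearity. *)
pose hn x : R := n.+1%:R^-1 * \sum_(k < n.+1) \1_(U k) x.
have hnh x : `|h x - hn x| <= n.+1%:R^-1 by exact: level_set_approx.
have n0 : 0 < n.+1%:R^-1 :> R by rewrite invr_gt0.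
have mind (A : set T) : open A -> measurable_fun setT (\1_A : Borel T -> R).
  by move=> oA; apply: measurable_indic; exact: open_Borel.
have ind1 (A : set T) x : `|\1_A x : R| <= 1.
  by rewrite indicE; case: (_ \in _); rewrite ?normr1 ?normr0.
have iU (mu : {finite_measure set (Borel T) -> \bar R}) (A : set T) :
    open A -> mu.-integrable setT (EFin \o (\1_A : Borel T -> R)).
  by move=> oA; apply: (bounded_integrable _ (mind _ oA) (ind1 A)).
have iUt (mu : {finite_measure set (Borel T) -> \bar R}) (A : set T) t :
    open A -> mu.-integrable setT
      (EFin \o (fun s : Borel T => \1_A (mul (inv s) t) : R)).
  move=> oA; rewrite (_ : (fun s => _) = \1_[set s | A (mul (inv s) t)]).
    by apply: iU; exact: open_translate.
  by apply/funext => s; rewrite !indicE.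
have mhn : measurable_fun setT (hn : Borel T -> R).
  apply: measurable_funM => //; apply: measurable_sum => k; exact: mind.
have ihn t (mu : {finite_measure set (Borel T) -> \bar R}) :
    \int[mu]_(s in [set: Borel T]) hn (mul (inv s) t) =
    n.+1%:R^-1 * \sum_(k < n.+1)
      \int[mu]_(s in [set: Borel T]) (\1_(U k) (mul (inv s) t) : R).
  rewrite RintegralZl//; last by apply: integrable_EFin_sum => k _; exact: iUt.
  by rewrite Rintegral_sum// => k _; exact: iUt.
have convhn t : conv_diff hn t =
    n.+1%:R^-1 * \sum_(k < n.+1) conv_diff \1_(U k) t.
  by rewrite /conv_diff !ihn -mulrBr -sumrB.
have ipU k : m.-integrable setT
    (EFin \o (fun t : Borel T => phi t * conv_diff \1_(U k) t)).
  exact: (bounded_mul_integrable mphi phiM (conv_diff_open_integrable (oU k))).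
have iUg k : m.-integrable setT (EFin \o (fun x : Borel T => \1_(U k) x * g x)).
  exact: (bounded_mul_integrable (mind _ (oU k)) (ind1 (U k)) ig).
have hnE x : hn x * g x = n.+1%:R^-1 * \sum_(k < n.+1) (\1_(U k) x * g x).
  by rewrite /hn -mulrA mulr_suml.
have phiE t : phi t * conv_diff hn t =
    n.+1%:R^-1 * \sum_(k < n.+1) (phi t * conv_diff \1_(U k) t).
  by rewrite convhn mulrCA mulr_sumr.
have e1 : \int[m]_(x in [set: Borel T]) (hn x * g x) =
    \int[m]_(t in [set: Borel T]) (phi t * conv_diff hn t).
  under eq_Rintegral do rewrite hnE.
  under [RHS]eq_Rintegral do rewrite phiE.
  rewrite !RintegralZl//; [|exact: integrable_EFin_sum|exact: integrable_EFin_sum].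
  rewrite !Rintegral_sum//; congr (_ * _); apply: eq_bigr => k _.
  rewrite -(H _ (oU k)) [RHS]Rintegral_mkcond; apply: eq_Rintegral => x _.
  by rewrite patchE indicE; case: (x \in U k); rewrite ?mul1r ?mul0r.
have ihng : m.-integrable setT (EFin \o (fun x : Borel T => hn x * g x)).
  under eq_fun do rewrite hnE.
  by apply: integrable_EFinZ; exact: integrable_EFin_sum.
have iphin : m.-integrable setT
    (EFin \o (fun t : Borel T => phi t * conv_diff hn t)).
  under eq_fun do rewrite phiE.
  by apply: integrable_EFinZ; exact: integrable_EFin_sum.
rewrite /C mulrDr.
rewrite -(subrKA (\int[m]_(x in [set: Borel T]) (hn x * g x))).
apply: (le_trans (ler_normD _ _)); apply: lerD.
  rewrite -RintegralB//.
  under eq_Rintegral do rewrite -mulrBl.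
  by apply: (@le_bounded_mul_Rintegral _ _ _ m (fun x : T => h x - hn x));
    [exact: measurable_funB|exact: hnh|exact: ig].
rewrite e1 -RintegralB//.
have -> : n.+1%:R^-1 * (M * (total * fine (m setT))) =
          (n.+1%:R^-1 * total * M) * fine (m setT) by ring.
apply: norm_Rintegral_le; first exact: (integrable_EFinB iphin iphic).
move=> t; rewrite -mulrBr normrM mulrC ler_pM//.
have ihnt (mu : {finite_measure set (Borel T) -> \bar R}) :
    mu.-integrable setT (EFin \o (fun s : Borel T => hn (mul (inv s) t))).
  by apply: integrable_EFinZ; apply: integrable_EFin_sum => k _; exact: iUt.
have iht (mu : {finite_measure set (Borel T) -> \bar R}) :
    mu.-integrable setT (EFin \o (fun s : Borel T => h (mul (inv s) t))).
  exact: (continuous_integrable mu cT (ctr t)).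
have -> : conv_diff hn t - conv_diff h t = conv_diff (fun x => hn x - h x) t.
  rewrite /conv_diff (RintegralB measurableT (ihnt mu1) (iht mu1)).
  rewrite (RintegralB measurableT (ihnt mu2) (iht mu2)).
  by rewrite !opprD !opprK addrACA.
apply: conv_diff_le => [|x]; last by rewrite distrC.
by have /measurable_int/measurable_EFinP := integrable_EFinB (ihnt mu1) (iht mu1).
Qed.

(** After [convolution_pairing], the difference of [g] and [translate_diff phi] is orthogonal to all
    continuous functions with values in [0, 1], hence has integral zero over every Borel set. *)
Lemma pairing_ae (phi g : T -> R) : continuous phi ->
  m.-integrable setT (EFin \o (g : Borel T -> R)) ->
  (forall U : set T, open U ->
    \int[m]_(x in (U : set (Borel T))) g x
    = \int[m]_(t in [set: Borel T]) (phi t * conv_diff \1_U t)) ->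
  {ae m, forall x : Borel T, g x = translate_diff phi x}.
Proof.
move=> cphi ig H.
have ctr (mu : {finite_measure set (Borel T) -> \bar R}) :
    continuous (fun x => \int[mu]_(s in [set: Borel T]) phi (mul s x)).
  apply: (@integral_continuous _ _ mu (fun s x => phi (mul s x)) cT) => p.
  by apply: continuous_comp; [exact: (continuous_mul tg)|exact: cphi].
have ctd : continuous (translate_diff phi).
  by move=> x; apply: cvgB; exact: ctr.
have itd := continuous_integrable m cT ctd.
have igd := integrable_EFinB ig itd.
have dens : forall A : set (Borel T), measurable A ->
    \int[m]_(x in A) (g x - translate_diff phi x) = 0.
  (* All three measures are [m], so the signed measure is zero. *)
  move=> A mA; rewrite -(regular_eq_density hT cT rm rm rm igd _ mA) ?subrr//.
  move=> h ch h01; rewrite subrr.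
  have mh := continuous_Borel ch.
  have hM x : `|h x| <= 1 by have /andP[? ?] := h01 x; rewrite ger0_norm.
  under eq_Rintegral do rewrite mulrBr.
  rewrite (RintegralB measurableT (bounded_mul_integrable mh hM ig)
    (bounded_mul_integrable mh hM itd)).
  rewrite (pairing_open_continuous cphi ig H ch h01).
  apply/esym/eqP; rewrite subr_eq0; apply/eqP.
  have [M M0 phiM] := compact_continuous_bounded cT cphi.
  have mphi := continuous_Borel cphi.
  have ich (mu : {finite_measure set (Borel T) -> \bar R}) : m.-integrable setT
      (EFin \o (fun t : Borel T => \int[mu]_(s in [set: Borel T]) h (mul (inv s) t))).
    apply: (continuous_integrable m cT).
    apply: (@integral_continuous _ _ mu (fun s t => h (mul (inv s) t)) cT) => p.
    by apply: continuous_comp; [exact: (continuous_divl tg)|exact: ch].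
  have icphi (mu : {finite_measure set (Borel T) -> \bar R}) :=
    continuous_integrable m cT (ctr mu).
  under eq_Rintegral do rewrite mulrBr.
  under [RHS]eq_Rintegral do rewrite mulrBr.
  rewrite (RintegralB measurableT (bounded_mul_integrable mphi phiM (ich mu1))
    (bounded_mul_integrable mphi phiM (ich mu2))).
  rewrite (RintegralB measurableT (bounded_mul_integrable mh hM (icphi mu1))
    (bounded_mul_integrable mh hM (icphi mu2))).
  by rewrite !convolution_pairing.
have : ae_eq m setT (EFin \o (g : Borel T -> R))
    (EFin \o (translate_diff phi : Borel T -> R)).
  apply: integral_ae_eq => //.
    by apply/measurable_EFinP; exact: continuous_Borel.
  move=> A _ mA.
  have iA f : m.-integrable setT (EFin \o (f : Borel T -> R)) ->
      m.-integrable A (EFin \o (f : Borel T -> R)).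
    by apply: integrableS.
  have := dens A mA; rewrite (RintegralB mA (iA _ ig) (iA _ itd)).
  move=> /eqP; rewrite subr_eq0 => /eqP gE.
  rewrite -[LHS]fineK ?integrable_fin_num//; last exact: iA.
  rewrite -[RHS]fineK ?integrable_fin_num//; last exact: iA.
  by congr EFin.
by apply: filterS => x /= /(_ I) [].
Qed.

End key_identity.

(** * Points of the support of a set *)

Section support.
Context {R : realType} {T : ptopologicalType}
  (m : {finite_measure set (Borel T) -> \bar R}) (hT : hausdorff_space T)
  (rm : regular_measure m).

(* [B] is not assumed to be measurable. *)
Lemma support_ae (B : set T) :
  {ae m, forall x : Borel T, B x ->
    forall W : set T, open W -> W x -> ~ m.-negligible (W `&` B : set (Borel T))}.
Proof.
have ch (x : T) : exists W : set T, (exists V : set T, [/\ open V, V x &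
      m.-negligible (V `&` B : set (Borel T))]) ->
    [/\ open W, W x & m.-negligible (W `&` B : set (Borel T))].
  have [[V VP]|nV] := pselect (exists V : set T, [/\ open V, V x &
      m.-negligible (V `&` B : set (Borel T))]); first by exists V.
  by exists set0 => /nV.
have [W WP] := choice ch.
pose D : set T := [set x | exists V : set T, [/\ open V, V x &
  m.-negligible (V `&` B : set (Borel T))]].
(* The claim is that [O] meets [B] in a negligible set. The union may be uncountable: only the trace
   on a compact subset of [O] is settled by a finite subcover. *)
pose O : set T := \bigcup_(x in D) W x.
have oO : open O by apply: bigcup_open => x /WP[].
have mO : measurable (O : set (Borel T)) by exact: open_Borel.
have fin (s : seq T) : (forall x, x \in s -> D x) ->
    m.-negligible (\bigcup_(x in [set` s]) (W x `&` B) : set (Borel T)).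
  elim: s => [_|x s ih sD].
    by rewrite set_nil bigcup_set0; exact: negligible_set0.
  apply: (negligibleS (A := (W x `&` B) `|`
    \bigcup_(y in [set` s]) (W y `&` B) : set (Borel T))).
    move=> y [z /=]; rewrite inE => /orP[/eqP-> ?|zs ?]; first by left.
    by right; exists z.
  apply: negligibleU.
    by have [] := WP x (sD x (mem_head _ _)).
  by apply: ih => y ys; apply: sD; rewrite in_cons ys orbT.
have KB (K : set T) : compact K -> K `<=` O ->
    m.-negligible (K `&` B : set (Borel T)).
  move=> cK KO; have := cK; rewrite compact_cover => /(_ _ D W).
  case=> [x /WP[]//|//|D' D'D KD'].
  apply: negligibleS (fin (finmap.enum_fset D') _).
    by move=> y [/KD'[x xD' Wx] By]; exists x.
  by move=> x /D'D; rewrite inE.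
have KV n : exists KV : set T * set T, [/\ compact KV.1, open KV.2,
    KV.1 `<=` O, O `<=` KV.2 & (m (KV.2 `\` KV.1) < (n.+1%:R^-1)%:E)%E].
  have [|K [V KVP]] := rm (eps := n.+1%:R^-1) mO; first by rewrite invr_gt0.
  by exists (K, V).
have [kv kvP] := choice KV.
(* By regularity, countably many compact sets exhaust [O] up to a null set. *)
pose rest : set (Borel T) := O `\` \bigcup_n (kv n).1.
have mK n : measurable ((kv n).1 : set (Borel T)).
  by apply: closed_Borel; apply: compact_closed => //; have [] := kvP n.
have mrest : measurable rest by apply: measurableD => //; exact: bigcupT_measurable.
have rest0 : m.-negligible rest.
  apply/negligibleP => //; apply/eqP; rewrite eq_le measure_ge0 andbT.
  apply/lee_addgt0Pr => eps e0; rewrite add0e.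
  pose n := Num.truncn eps^-1.
  have [_ oV _ OV mVK] := kvP n.
  apply: (@le_trans _ _ (n.+1%:R^-1)%:E).
    apply: (le_trans _ (ltW mVK)); apply: le_measure; rewrite ?inE//.
      by apply: measurableD => //; exact: open_Borel.
    by move=> x [/OV Vx nK]; split => // Kx; apply: nK; exists n.
  by rewrite lee_fin invf_ple ?posrE// ltW// truncnS_gt.
apply: (negligibleS (A := \bigcup_n ((kv n).1 `&` B) `|` rest : set (Borel T))).
  move=> x /= /not_implyP[Bx] /existsNP[V] /not_implyP[oV].
  move=> /not_implyP[Vx] /contrapT nVB.
  have Dx : D x by exists V.
  have Ox : O x by exists x => //; have [] := WP x Dx.
  have [[n _ Kx]|nK] := pselect ((\bigcup_n (kv n).1) x); last by right.
  by left; exists n.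
apply: negligibleU => //; apply: negligible_bigcup => n.
by have [cK _ KO _ _] := kvP n; exact: KB.
Qed.

(** Exchange of the quantifiers over [phi] and over almost every [x]. The exceptional set depends
    only on the countable families [B j]; the weak identity is used at a nearby point [y] of the
    same piece, never at [x]. *)
Lemma strong_ae (H : T -> T -> R) (b : (T -> R) -> T -> R) :
  compact [set: T] ->
  (forall x, m.-integrable setT (EFin \o (H x : Borel T -> R))) ->
  (forall phi : T -> R, continuous phi -> continuous (b phi)) ->
  (forall eps, 0 < eps -> exists B : nat -> set T,
    {ae m, forall x : Borel T, exists k, B k x} /\
    forall k x y, B k x -> B k y ->
      \int[m]_(t in [set: Borel T]) `|H x t - H y t| <= eps) ->
  (forall phi : T -> R, continuous phi -> {ae m, forall x : Borel T,
    \int[m]_(t in [set: Borel T]) (phi t * H x t) = b phi x}) ->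
  {ae m, forall x : Borel T, forall phi : T -> R, continuous phi ->
    \int[m]_(t in [set: Borel T]) (phi t * H x t) = b phi x}.
Proof.
move=> cT iH cb sep weak.
have ch (j : nat) : exists B : nat -> set T,
    {ae m, forall x : Borel T, exists k, B k x} /\
    forall k x y, B k x -> B k y ->
      \int[m]_(t in [set: Borel T]) `|H x t - H y t| <= j.+1%:R^-1.
  by apply: sep; rewrite invr_gt0.
have [B BP] := choice ch.
have ae1 : {ae m, forall x : Borel T, forall j, exists k, B j k x}.
  by apply/ae_foralln => j; have [] := BP j.
have ae2 : {ae m, forall x : Borel T, forall j k, B j k x ->
    forall W : set T, open W -> W x ->
    ~ m.-negligible (W `&` B j k : set (Borel T))}.
  apply/ae_foralln => j; apply/ae_foralln => k; exact: support_ae.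
apply: filterS2 ae1 ae2 => x x1 x2 phi cphi.
have [M M0 phiM] := compact_continuous_bounded cT cphi.
have mphi := continuous_Borel cphi.
apply/eqP; rewrite -subr_eq0 -normr_eq0 eq_le normr_ge0 andbT.
apply/ler_addgt0Pr => eps e0; rewrite add0r.
have e20 : 0 < eps / 2 by rewrite divr_gt0.
(* The precision [j] may depend on the bound [M] of [phi], since [x] is good for all [j] at once. *)
pose j := Num.truncn (M / (eps / 2)).
have jM : M * j.+1%:R^-1 <= eps / 2.
  by rewrite ler_pdivrMr// mulrC -ler_pdivrMr// ltW// truncnS_gt.
have [k Bk] := x1 j.
pose W := [set y | `|b phi x - b phi y| < eps / 2].
have oW : open W.
  apply: (@open_comp _ _ (fun y => `|b phi x - b phi y|) [set r | r < eps / 2]).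
    move=> y _; apply: (@continuous_comp _ _ _ (fun y => b phi x - b phi y) Num.norm).
      by apply: cvgB; [exact: cvg_cst|exact: cb].
    exact: norm_continuous.
  exact: open_lt.
have Wx : W x by rewrite /W/= subrr normr0.
have nneg := x2 j k Bk W oW Wx.
have [y [[Wy By] Hy]] : exists y, (W `&` B j k) y /\
    \int[m]_(t in [set: Borel T]) (phi t * H y t) = b phi y.
  (* Otherwise the part of [B j k] inside [W] would lie in the exceptional set of [phi]. *)
  apply: contrapT => ne; apply: nneg; apply: negligibleS (weak _ cphi).
  by move=> y WBy /= Hy; apply: ne; exists y.
rewrite -(subrKA (b phi y)) (le_trans (ler_normD _ _))// [leRHS]splitr.
apply: lerD; last by rewrite distrC ltW.
rewrite -Hy -(RintegralB measurableT (bounded_mul_integrable mphi phiM (iH x))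
  (bounded_mul_integrable mphi phiM (iH y))).
under eq_Rintegral do rewrite -mulrBr.
have := le_bounded_mul_Rintegral mphi phiM (integrable_EFinB (iH x) (iH y)).
move=> /le_trans; apply; apply: le_trans jM.
by rewrite ler_pM2l//; have [_] := BP j; apply; [exact: Bk|exact: By].
Qed.

End support.

(** * Approximation by simple functions in mean *)

(** Turns convergence of extended-real bounds, such as Luxemburg norms, into convergence of the real
    quantities that they dominate; [c] absorbs the embedding constant. *)
Lemma cvg_ereal_dist (R : realType) (r : nat -> R) (x c : R) (v : nat -> \bar R) :
  0 < c -> (forall n, ((c * `|r n - x|)%:E <= v n)%E) ->
  v @ \oo --> (0 : \bar R) -> r @ \oo --> x.
Proof.
move=> c0 rv /fine_cvgP[vfin /cvgrPdist_lt v0].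
apply/cvgrPdist_lt => eps e0.
have ce0 : 0 < c * eps by rewrite mulr_gt0.
have := v0 _ ce0; apply: filterS2 vfin => n vn.
rewrite /= sub0r normrN => ve.
rewrite distrC -(ltr_pM2l c0); apply: le_lt_trans ve.
rewrite -lee_fin; apply: (le_trans (rv n)).
by rewrite -[leLHS](fineK vn) lee_fin ler_norm.
Qed.

(** * Measurable limits and pairings of simple functions *)

Section L1_limits.
Context d (X : measurableType d) (R : realType)
  (m : {finite_measure set X -> \bar R}).

(** Cutting off on a measurable null set that contains the bad points makes the convergence hold
    everywhere. *)
Lemma ae_limit_measurable (a : nat -> X -> R) (al : X -> R) :
  (forall n, measurable_fun setT (a n)) ->
  {ae m, forall x, a ^~ x @ \oo --> al x} ->
  exists2 al' : X -> R, measurable_fun setT al' & {ae m, forall x, al' x = al x}.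
Proof.
move=> ma [N [mN N0 aN]].
have mCN : measurable_fun setT (\1_(~` N) : X -> R).
  by apply: measurable_indic; exact: measurableC.
exists (fun x => al x * \1_(~` N) x).
  apply: (@measurable_fun_cvg _ _ _ _ (fun n x => a n x * \1_(~` N) x)).
    by move=> n; exact: measurable_funM.
  move=> x _; have [Nx|nNx] := pselect (N x).
    rewrite (_ : _ * _ = 0); last by rewrite indicE memNset ?mulr0// => /(_ Nx).
    rewrite (_ : (fun n => _) = cst 0); first exact: cvg_cst.
    by apply/funext => n; rewrite indicE memNset ?mulr0// => /(_ Nx).
  apply: cvgM; last exact: cvg_cst.
  by apply: contrapT => nc; apply: nNx; exact: aN.
exists N; split => // x /= neq; apply: contrapT => nNx; apply: neq.
by rewrite indicE mem_set// mulr1.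
Qed.

(* [al] and [u] need not be measurable: the Luxemburg norm of [F x] is not known
   to be a measurable function of [x]. *)
Lemma ae_cvg_L1 (a : nat -> X -> R) (al al' : X -> R) (u : nat -> X -> \bar R)
    (c : R) :
  0 < c -> (forall n, measurable_fun setT (a n)) -> measurable_fun setT al' ->
  {ae m, forall x, al' x = al x} ->
  (forall n x, ((c * `|a n x - al x|)%:E <= u n x)%E) ->
  (fun n => \int[m]_x u n x)%E @ \oo --> (0 : \bar R) ->
  (fun n => \int[m]_x (c * `|a n x - al' x|)%:E)%E @ \oo --> (0 : \bar R).
Proof.
move=> c0 ma mal' [N [mN N0 aN]] au u0.
have mCN : measurable_fun setT (\1_(~` N) : X -> R).
  by apply: measurable_indic; exact: measurableC.
apply: (@squeeze_cvge _ _ _ _ (cst 0%E) _ (fun n => \int[m]_x u n x)%E) => //;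
  last exact: cvg_cst.
apply: nearW => n; apply/andP; split.
  by apply: integral_ge0 => x _; rewrite lee_fin mulr_ge0// ltW.
have mdiff : measurable_fun setT (fun x => c * `|a n x - al' x|).
  apply: measurable_funM => //; apply: measurableT_comp => //.
  exact: measurable_funB.
(* The cut-off integrand has the same integral and lies below [u n] everywhere, as the comparison of
   lower integrals requires. *)
rewrite (@ge0_ae_eq_integral _ _ _ m setT _
    (fun x => (c * `|a n x - al' x| * \1_(~` N) x)%:E))//.
- apply: le_lower_integral => x.
    by rewrite lee_fin !mulr_ge0// ltW.
  have [Nx|nNx] := pselect (N x).
    rewrite indicE memNset ?mulr0; last by move=> /(_ Nx).
    by apply: le_trans (au n x); rewrite lee_fin mulr_ge0// ltW.
  rewrite indicE mem_set// mulr1 (_ : al' x = al x)//.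
  by apply: contrapT => nc; apply: nNx; exact: aN.
- exact/measurable_EFinP.
- by apply/measurable_EFinP; exact: measurable_funM.
- by move=> x _; rewrite lee_fin mulr_ge0// ltW.
- by move=> x _; rewrite lee_fin !mulr_ge0// ltW.
- exists N; split => // x /= neq; apply: contrapT => nNx; apply: neq => _.
  by rewrite indicE mem_set// mulr1.
Qed.

Definition rsimple_eval (s : seq (set X * (X -> R))) (x t : X) : R :=
  \sum_(p <- s) \1_(p.1) x * p.2 t.

Definition rsimple_int (s : seq (set X * (X -> R))) (A : set X) (t : X) : R :=
  \sum_(p <- s) fine (m (A `&` p.1)) * p.2 t.

Definition rsimple_ok (s : seq (set X * (X -> R))) :=
  forall p, List.In p s ->
    measurable p.1 /\ m.-integrable setT (EFin \o p.2).

Lemma rsimple_eval_integrable s x : rsimple_ok s ->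
  m.-integrable setT (EFin \o rsimple_eval s x).
Proof.
move=> oks; apply: integrable_EFin_sum => p /oks[_ ip].
exact: integrable_EFinZ.
Qed.

Lemma rsimple_int_integrable s A : rsimple_ok s ->
  m.-integrable setT (EFin \o rsimple_int s A).
Proof.
move=> oks; apply: integrable_EFin_sum => p /oks[_ ip].
exact: integrable_EFinZ.
Qed.

(** Membership bits determine the value, so a simple function takes finitely many values: this is
    the source of separability. *)
Lemma rsimple_eval_eq s x y :
  [seq x \in p.1 | p <- s] = [seq y \in p.1 | p <- s] ->
  rsimple_eval s x = rsimple_eval s y.
Proof.
move=> e; apply/funext => t; rewrite /rsimple_eval.
elim: s e => [_|p s ih /= [e1 e2]]; first by rewrite !big_nil.
by rewrite !big_cons ih// !indicE e1.
Qed.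

Section pairing.
Context (phi : X -> R) (M : R) (mphi : measurable_fun setT phi)
  (phiM : forall x, `|phi x| <= M).

Lemma rsimple_eval_pairingE s x : rsimple_ok s ->
  \int[m]_t (phi t * rsimple_eval s x t)
  = \sum_(p <- s) \1_(p.1) x * \int[m]_t (phi t * p.2 t).
Proof.
move=> oks; under eq_Rintegral do rewrite /rsimple_eval mulr_sumr.
have ip p : List.In p s -> m.-integrable setT (EFin \o (fun t => phi t * p.2 t)).
  by move=> /oks[_]; exact: bounded_mul_integrable.
have e p t : phi t * (\1_(p.1) x * p.2 t) = \1_(p.1) x * (phi t * p.2 t).
  by rewrite mulrCA.
under eq_Rintegral do (under eq_bigr do rewrite e).
rewrite Rintegral_sum; last by move=> p ps; apply: integrable_EFinZ; exact: ip.
elim: s oks ip => [_ _|p s ih oks ip]; first by rewrite !big_nil.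
rewrite !big_cons ih; [|by move=> q qs; apply: oks; right
  |by move=> q qs; apply: ip; right].
by rewrite RintegralZl//; apply: ip; left.
Qed.

Lemma rsimple_eval_pairing_integrable s : rsimple_ok s ->
  m.-integrable setT (EFin \o (fun x => \int[m]_t (phi t * rsimple_eval s x t))).
Proof.
move=> oks; under eq_fun do rewrite rsimple_eval_pairingE//.
apply: integrable_EFin_sum => p /oks[mp _].
under eq_fun do rewrite mulrC.
apply: integrable_EFinZ; apply: (@bounded_integrable _ _ _ _ _ 1).
  exact: measurable_indic.
by move=> x; rewrite indicE; case: (_ \in _); rewrite ?normr1 ?normr0.
Qed.

(** Pairing with [phi] commutes with vector integration, here by finite linearity. *)
Lemma rsimple_int_pairing s A : rsimple_ok s -> measurable A ->
  \int[m]_(x in A) \int[m]_t (phi t * rsimple_eval s x t)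
  = \int[m]_t (phi t * rsimple_int s A t).
Proof.
move=> oks mA; under eq_Rintegral do rewrite rsimple_eval_pairingE//.
rewrite /rsimple_int.
elim: s oks => [_|p s ih oks].
  under eq_Rintegral do rewrite big_nil.
  under [RHS]eq_Rintegral do rewrite big_nil mulr0.
  by rewrite !Rintegral_cst// !mul0r.
have okS : rsimple_ok s by move=> q qs; apply: oks; right.
have [mp ip] : measurable p.1 /\ m.-integrable setT (EFin \o p.2).
  by apply: oks; left.
have ii : m.-integrable setT (EFin \o (\1_(p.1) : X -> R)).
  apply: (@bounded_integrable _ _ _ _ _ 1); first exact: measurable_indic.
  by move=> x; rewrite indicE; case: (_ \in _); rewrite ?normr1 ?normr0.
have iA f : m.-integrable setT (EFin \o (f : X -> R)) ->
    m.-integrable A (EFin \o f) by apply: integrableS.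
have i1 : m.-integrable setT
    (EFin \o (fun x => \1_(p.1) x * \int[m]_t (phi t * p.2 t))).
  by under eq_fun do rewrite mulrC; exact: integrable_EFinZ.
have i2 : m.-integrable setT
    (EFin \o (fun x => \sum_(q <- s) \1_(q.1) x * \int[m]_t (phi t * q.2 t))).
  have := rsimple_eval_pairing_integrable okS.
  by under eq_fun do rewrite rsimple_eval_pairingE//.
under eq_Rintegral do rewrite big_cons.
rewrite RintegralD//; [|exact: iA|exact: iA].
rewrite ih// RintegralZr//; last exact: iA.
under [RHS]eq_Rintegral do rewrite big_cons mulrDr mulrCA.
rewrite RintegralD//; last 2 first.
- by apply: integrable_EFinZ; exact: bounded_mul_integrable.
- by apply: bounded_mul_integrable => //; exact: (rsimple_int_integrable A okS).
congr (_ + _); rewrite RintegralZl//; last exact: bounded_mul_integrable.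
by congr (_ * _); rewrite /Rintegral integral_indic// setIC.
Qed.

End pairing.
End L1_limits.

(** * Separability of the range and weak integrals *)

Section L1_approximation.
Context d (X : measurableType d) (R : realType)
  (m : {finite_measure set X -> \bar R}).

(** What a Bochner approximation leaves for one real component: [u] stands for the Luxemburg
    distances, with no measurability required, and [c] for the constant of the embedding into
    L^1. *)
Definition L1_approx (H : X -> X -> R) (S : nat -> seq (set X * (X -> R))) :=
  exists (c : R) (u : nat -> X -> \bar R), [/\ 0 < c,
    forall n, rsimple_ok m (S n),
    forall n x, ((c * \int[m]_t `|rsimple_eval (S n) x t - H x t|)%:E <= u n x)%E,
    {ae m, forall x, u ^~ x @ \oo --> (0 : \bar R)} &
    (fun n => \int[m]_x u n x)%E @ \oo --> (0 : \bar R)].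

Context (H : X -> X -> R) (iH : forall x, m.-integrable setT (EFin \o H x)).

(** A piece collects the points where the [n]-th approximation is within [eps / 2] and takes the
    value coded by the bits [v]. Pairs (n, v) are countable, and two points of a piece share the
    approximating value. *)
Lemma L1_approx_separable S (eps : R) : L1_approx H S -> 0 < eps ->
  exists B : nat -> set X, {ae m, forall x, exists k, B k x} /\
    forall k x y, B k x -> B k y -> \int[m]_t `|H x t - H y t| <= eps.
Proof.
move=> [c [u [c0 okS Su u0 _]]] e0.
have e20 : 0 < eps / 2 by rewrite divr_gt0.
pose bits n x := [seq x \in p.1 | p <- S n].
(* Numbers that code no pair index the empty set. *)
pose B k : set X := if unpickle k is Some (n, v) then
  [set x | bits n x = v /\ \int[m]_t `|rsimple_eval (S n) x t - H x t| <= eps / 2]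
  else set0.
exists B; split.
  apply: filterS u0 => x ux.
  have : (fun n => \int[m]_t `|rsimple_eval (S n) x t - H x t|) @ \oo --> (0 : R).
    apply: (cvg_ereal_dist c0 _ ux) => n.
    rewrite subr0 ger0_norm//; apply: Rintegral_ge0 => t _; exact: normr_ge0.
  move=> /cvgrPdist_le/(_ _ e20)[n _ /(_ n (leqnn n))] /=.
  rewrite sub0r normrN => /(le_trans (ler_norm _)) sn.
  by exists (pickle (n, bits n x)); rewrite /B pickleK.
move=> k x y; rewrite /B; case: (unpickle k) => [[n v]|//] [bx sx] [by_ sy].
have exy : rsimple_eval (S n) x = rsimple_eval (S n) y.
  by apply: rsimple_eval_eq; exact: (etrans bx (esym by_)).
have is_ z := rsimple_eval_integrable z (okS n).
have i1 z := integrable_norm (integrable_EFinB (is_ z) (iH z)).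
apply: (@le_trans _ _ (\int[m]_t (`|rsimple_eval (S n) x t - H x t|
   + `|rsimple_eval (S n) y t - H y t|))).
  apply: le_Rintegral => //.
  - exact: (integrable_norm (integrable_EFinB (iH x) (iH y))).
  - exact: (integrable_EFinD (i1 x) (i1 y)).
  move=> t _; rewrite -(subrKA (rsimple_eval (S n) y t)).
  by rewrite (le_trans (ler_normD _ _))// -exy [in leLHS]distrC.
by rewrite (RintegralD measurableT (i1 x) (i1 y)) [leRHS]splitr lerD.
Qed.

(** The functional [phi] commutes with the Bochner integral. The approximating sequence may change
    with [A], but every such sequence, paired with [phi], converges in mean to the same [al]; the
    integrals over [A] then have two limits, which must agree. [C] will be the class of open
    sets. *)
Lemma weak_bochner (phi : X -> R) (M : R) (C : set (set X)) (gA : set X -> X -> R) :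
  measurable_fun setT phi -> (forall x, `|phi x| <= M) -> 0 < M ->
  C setT -> C `<=` measurable ->
  (forall A, C A -> m.-integrable setT (EFin \o gA A)) ->
  (forall A, C A -> exists S, L1_approx H S /\
    exists (c : R) (w : nat -> \bar R), [/\ 0 < c,
      forall n, ((c * \int[m]_t `|rsimple_int m (S n) A t - gA A t|)%:E <= w n)%E &
      w @ \oo --> (0 : \bar R)]) ->
  exists al : X -> R, [/\ m.-integrable setT (EFin \o al),
    {ae m, forall x, al x = \int[m]_t (phi t * H x t)} &
    forall A, C A -> \int[m]_(x in A) al x = \int[m]_t (phi t * gA A t)].
Proof.
move=> mphi phiM M0 CT Cm igA HC.
pose a (S : nat -> seq (set X * (X -> R))) n x :=
  \int[m]_t (phi t * rsimple_eval (S n) x t).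
have Rle (f : X -> R) (k : R) : m.-integrable setT (EFin \o f) -> 0 < k ->
    k / M * `|\int[m]_t (phi t * f t)| <= k * \int[m]_t `|f t|.
  move=> fi k0; rewrite -mulrA ler_pM2l// ler_pdivrMl//.
  exact: le_bounded_mul_Rintegral.
have aE S n x : rsimple_ok m (S n) -> a S n x - \int[m]_t (phi t * H x t) =
    \int[m]_t (phi t * (rsimple_eval (S n) x t - H x t)).
  move=> oks; rewrite /a -(RintegralB measurableT
    (bounded_mul_integrable mphi phiM (rsimple_eval_integrable x oks))
    (bounded_mul_integrable mphi phiM (iH x))).
  by apply: eq_Rintegral => t _; rewrite mulrBr.
have au S c u : 0 < c -> (forall n, rsimple_ok m (S n)) ->
   (forall n x, ((c * \int[m]_t `|rsimple_eval (S n) x t - H x t|)%:E <= u n x)%E) ->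
   forall n x, ((c / M * `|a S n x - \int[m]_t (phi t * H x t)|)%:E <= u n x)%E.
  move=> c0 oks Su n x; apply: le_trans (Su n x); rewrite lee_fin aE//.
  apply: Rle => //.
  exact: (integrable_EFinB (rsimple_eval_integrable x (oks n)) (iH x)).
have ia S n : rsimple_ok m (S n) -> m.-integrable setT (EFin \o a S n).
  exact: (rsimple_eval_pairing_integrable mphi phiM).
have ma S n : rsimple_ok m (S n) -> measurable_fun setT (a S n).
  by move=> /(ia S n)/measurable_int/measurable_EFinP.
(* The sequence attached to the whole space serves to define [al]. *)
have [S0 [[c [u [c0 okS Su u0 iu0]]] _]] := HC _ CT.
have cM0 : 0 < c / M by rewrite divr_gt0.
have [al mal alE] : exists2 al : X -> R, measurable_fun setT al &
    {ae m, forall x, al x = \int[m]_t (phi t * H x t)}.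
  apply: (@ae_limit_measurable _ _ _ m (a S0)) => [n|]; first exact: ma.
  apply: filterS u0 => x ux.
  by apply: (cvg_ereal_dist cM0 _ ux) => n; exact: au.
have L1al S (c1 : R) u1 : 0 < c1 -> (forall n, rsimple_ok m (S n)) ->
   (forall n x, ((c1 * \int[m]_t `|rsimple_eval (S n) x t - H x t|)%:E <= u1 n x)%E) ->
   (fun n => \int[m]_x u1 n x)%E @ \oo --> (0 : \bar R) ->
   (fun n => \int[m]_x (c1 / M * `|a S n x - al x|)%:E)%E @ \oo --> (0 : \bar R).
  move=> c10 okS1 Su1 u10; apply: (ae_cvg_L1 _ _ mal alE _ u10).
  - by rewrite divr_gt0.
  - by move=> n; exact: ma.
  - exact: au.
have ial : m.-integrable setT (EFin \o al).
  (* One index at finite mean distance suffices: [al] is an integrable function minus an integrable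
     error. *)
  have /fine_cvgP[[n _ /(_ n (leqnn n)) fn] _] := L1al _ _ _ c0 okS Su iu0.
  have idif : m.-integrable setT (EFin \o (fun x => c / M * (a S0 n x - al x))).
    apply/integrableP; split.
      apply/measurable_EFinP; apply: measurable_funM => //.
      by apply: measurable_funB => //; exact: ma.
    move: fn; rewrite /= ge0_fin_numE; last first.
      by apply: integral_ge0 => x _; rewrite lee_fin mulr_ge0// ltW.
    apply: le_lt_trans; under eq_integral do rewrite normrM gtr0_norm//.
    exact: lexx.
  have := integrable_EFinB (ia S0 n (okS n)) (integrable_EFinZ (c / M)^-1 idif).
  congr (m.-integrable _ _); apply/funext => x /=; congr EFin.
  by rewrite mulKf ?gt_eqF// opprB addrC subrK.
exists al; split => // A CA.
have [S [[c1 [u1 [c10 okS1 Su1 u10 iu10]]] [c2 [w [c20 Sw w0]]]]] := HC _ CA.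
have mA := Cm _ CA.
have := L1al _ _ _ c10 okS1 Su1 iu10.
pose r n := \int[m]_(x in A) a S n x.
have ib (f : X -> R) (B : set X) : measurable B ->
    m.-integrable setT (EFin \o f) -> m.-integrable B (EFin \o f).
  by move=> mB; apply: integrableS.
move=> /(@cvg_ereal_dist _ r (\int[m]_(x in A) al x) (c1 / M)) r1.
have rx : r @ \oo --> \int[m]_(x in A) al x.
  apply: r1 => [|n]; first by rewrite divr_gt0.
  have id := integrable_EFinB (ia S n (okS1 n)) ial.
  rewrite /r -(RintegralB mA (ib _ _ mA (ia S n (okS1 n))) (ib _ _ mA ial)).
  apply: (@le_trans _ _ (c1 / M * \int[m]_x `|a S n x - al x|)%:E).
    rewrite lee_fin ler_pM2l ?divr_gt0//.
    have -> : \int[m]_(x in A) (a S n x - al x)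
        = \int[m]_x (\1_A x * (a S n x - al x)).
      rewrite Rintegral_mkcond; apply: eq_Rintegral => x _.
      by rewrite patchE indicE; case: (x \in A); rewrite ?mul1r ?mul0r.
    rewrite -[leRHS]mul1r; apply: (@le_bounded_mul_Rintegral _ _ _ m \1_A _ 1 _ _ id).
      exact: measurable_indic.
    by move=> x; rewrite indicE; case: (_ \in _); rewrite ?normr1 ?normr0.
  have -> : (\int[m]_x (c1 / M * `|a S n x - al x|)%:E)%E =
     (\int[m]_x (c1 / M * `|a S n x - al x|))%:E.
    rewrite /Rintegral fineK//; apply: integrable_fin_num => //.
    exact: (integrable_EFinZ (c1 / M) (integrable_norm id)).
  by rewrite RintegralZl//; exact: integrable_norm id.
have ry : r @ \oo --> \int[m]_t (phi t * gA A t).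
  apply: (@cvg_ereal_dist _ r _ (c2 / M) w _ _ w0); first by rewrite divr_gt0.
  move=> n; apply: le_trans (Sw n); rewrite lee_fin.
  have isi := rsimple_int_integrable A (okS1 n).
  rewrite /r (rsimple_int_pairing mphi phiM (okS1 n) mA).
  rewrite -(RintegralB measurableT (bounded_mul_integrable mphi phiM isi)
    (bounded_mul_integrable mphi phiM (igA _ CA))).
  under eq_Rintegral do rewrite -mulrBr.
  apply: Rle => //; exact: (integrable_EFinB isi (igA _ CA)).
exact: (cvg_unique _ rx ry).
Qed.

End L1_approximation.

(** * Density of one real component of the measure *)

Section group_density.
Context {R : realType} {T : ptopologicalType} (mul : T -> T -> T) (inv : T -> T)
  (e : T) (tg : topological_group mul inv e).
Context (hT : hausdorff_space T) (cT : compact [set: T])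
  (m : {finite_measure set (Borel T) -> \bar R})
  (mT : m [set: T] = 1%E) (rm : regular_measure m)
  (linv : forall (x : T) (A : set (Borel T)), measurable A ->
    m (mul x @` A) = m A).

Let mr y := continuous_Borel_Borel (@continuous_mulr _ _ _ _ tg y).

Lemma ge0_integral_right_invariant (f : T -> \bar R) y :
  measurable_fun setT (f : Borel T -> \bar R) -> (forall x, 0 <= f x)%E ->
  (\int[m]_(t in [set: Borel T]) f (mul t y)
  = \int[m]_(t in [set: Borel T]) f t)%E.
Proof.
move=> mf f0.
transitivity (\int[pushforward m (mul ^~ y : Borel T -> Borel T)]_t f t)%E.
  by rewrite (ge0_integral_pushforward (mr y))// preimage_setT.
apply: eq_measure_integral => A mA _.
exact: (measure_right_invariant tg hT cT mT rm linv).
Qed.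

Lemma right_translate_integrable (f : T -> R) y :
  m.-integrable setT (EFin \o (f : Borel T -> R)) ->
  m.-integrable setT (EFin \o (fun t : Borel T => f (mul t y))).
Proof.
move=> /integrableP[mf fi]; apply/integrableP; split.
  by apply: (measurableT_comp mf); exact: mr.
rewrite (@ge0_integral_right_invariant (fun t => `|(f t)%:E|%E))//.
exact: (measurableT_comp (@abse_measurable R _) mf).
Qed.

Lemma integral_right_invariant (f : T -> R) y :
  m.-integrable setT (EFin \o (f : Borel T -> R)) ->
  \int[m]_(t in [set: Borel T]) f (mul t y) = \int[m]_(t in [set: Borel T]) f t.
Proof.
move=> fi; rewrite /Rintegral; congr fine.
transitivity (\int[pushforward m (mul ^~ y : Borel T -> Borel T)]_t (f t)%:E)%E.
  rewrite (integral_pushforward (mr y) (mu := m) (f := EFin \o (f : Borel T -> R)))//.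
  - exact: (measurable_int m fi).
  - by rewrite preimage_setT; exact: (right_translate_integrable y fi).
apply: eq_measure_integral => A mA _.
exact: (measure_right_invariant tg hT cT mT rm linv).
Qed.

Context (mu1 mu2 : {finite_measure set (Borel T) -> \bar R})
  (r1 : regular_measure mu1) (r2 : regular_measure mu2).

(** [weak_bochner] on open sets and [pairing_ae] identify the pairings of [H x]; [strong_ae] makes
    the good [x] independent of the test function, and right invariance moves the translation from
    the measure to the density. *)
Lemma convolution_density_ae (H : T -> T -> R) :
  (forall x, m.-integrable setT (EFin \o (H x : Borel T -> R))) ->
  (forall U : set T, open U -> exists S, L1_approx m H S /\
    exists (c : R) (w : nat -> \bar R), [/\ 0 < c,
      forall n, ((c * \int[m]_(t in [set: Borel T])
        `|rsimple_int m (S n) U t - conv_diff mul inv mu1 mu2 \1_U t|)%:E <= w n)%E &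
      w @ \oo --> (0 : \bar R)]) ->
  {ae m, forall x : Borel T, forall A : set (Borel T), measurable A ->
    fine (mu1 A) - fine (mu2 A) = \int[m]_(t in A) H x (mul t x)}.
Proof.
move=> iH HU.
have weak (phi : T -> R) : continuous phi -> {ae m, forall x : Borel T,
    \int[m]_(t in [set: Borel T]) (phi t * H x t)
    = translate_diff mul mu1 mu2 phi x}.
  move=> cphi.
  have [M M0 phiM] := compact_continuous_bounded cT cphi.
  have mphi := continuous_Borel cphi.
  have [al [ial alH alU]] := @weak_bochner _ (Borel T) R m H iH phi M (@open T) _
    mphi phiM M0 openT (fun U => @open_Borel T U)
    (fun U oU => conv_diff_open_integrable tg hT m r1 r2 oU) HU.
  have alb := pairing_ae tg hT cT rm linv r1 r2 cphi ial alU.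
  by apply: filterS2 alH alb => x <-.
have sep (eps : R) : 0 < eps -> exists B : nat -> set T,
    {ae m, forall x : Borel T, exists k, B k x} /\
    forall k x y, B k x -> B k y ->
      \int[m]_(t in [set: Borel T]) `|H x t - H y t| <= eps.
  have [S [HS _]] := HU _ openT.
  exact: (@L1_approx_separable _ (Borel T) R m H iH S eps HS).
have cb (phi : T -> R) : continuous phi ->
    continuous (translate_diff mul mu1 mu2 phi).
  move=> cphi x; apply: cvgB;
    apply: (@integral_continuous _ _ _ (fun s x => phi (mul s x)) cT) => p;
    by apply: continuous_comp; [exact: (continuous_mul tg)|exact: cphi].
have := strong_ae hT rm cT iH cb sep weak.
apply: filterS => x Hx A mA.
apply: (regular_eq_density hT cT rm r1 r2 (g := fun t => H x (mul t x))) => //.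
  exact: (right_translate_integrable x (iH x)).
move=> psi cpsi psi01.
(* The test function is translated so that its value at [mul s x] is [psi s]. It depends on [x],
   which is possible because the exceptional set does not depend on the test function. *)
have cpx : continuous (fun t => psi (mul t (inv x))).
  move=> t; apply: (@continuous_comp _ _ _ (mul ^~ (inv x)) psi).
    exact: (continuous_mulr tg).
  exact: cpsi.
have := Hx _ cpx; rewrite /translate_diff.
have e1 (mu : {finite_measure set (Borel T) -> \bar R}) :
    \int[mu]_(s in [set: Borel T]) psi (mul (mul s x) (inv x))
    = \int[mu]_(s in [set: Borel T]) psi s.
  by apply: eq_Rintegral => s _; rewrite (tg_mulgK tg).
rewrite !e1 => <-.
have [M M0 phiM] := compact_continuous_bounded cT cpx.
rewrite -(integral_right_invariant x
  (bounded_mul_integrable (continuous_Borel cpx) phiM (iH x))).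
by apply: eq_Rintegral => t _; rewrite (tg_mulgK tg).
Qed.

End group_density.

(** * Young functions and the Luxemburg norm *)

Section young.
Context {R : realType} (Phi : R -> \bar R) (Y : young_function Phi).

(** Convexity between 0 and [y], with weight [x / y]. *)
Lemma young_le_scale (x y : R) : 0 <= x -> x <= y -> 0 < y ->
  (Phi x <= (x / y)%:E * Phi y)%E.
Proof.
case: Y => P0 Pge0 Pc _ x0 xy y0.
have l0 : 0 <= x / y by rewrite divr_ge0// ltW.
have l1 : x / y <= 1 by rewrite ler_pdivrMr// mul1r.
have := Pc y 0 (x / y) (ltW y0) (lexx _) l0 l1.
by rewrite mulr0 addr0 divfK ?gt_eqF// P0 mule0 adde0.
Qed.

Lemma young_nondecreasing (x y : R) : 0 <= x -> x <= y -> (Phi x <= Phi y)%E.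
Proof.
move=> x0; rewrite le_eqVlt => /predU1P[->//|xy].
have y0 := le_lt_trans x0 xy.
have Py : (0 <= Phi y)%E by case: Y => _ + _ _; apply; exact: ltW.
apply: (le_trans (young_le_scale x0 (ltW xy) y0)).
rewrite -[leRHS]mul1e; apply: lee_wpmul2r => //.
by rewrite lee_fin ler_pdivrMr// mul1r ltW.
Qed.

(** Take [x1] with [Phi x1] at least 1. Beyond [x1], scaling gives at least [x / x1]; below it, the
    bound is nonpositive. This is what embeds L^Phi into L^1 for a finite measure. *)
Lemma young_linear_bound : exists2 x1, 0 < x1 &
  forall x, 0 <= x -> ((x / x1 - 1)%:E <= Phi x)%E.
Proof.
have [P0 Pge0 Pc /cvgeyPge/(_ 1)[M [_ PM]]] := Y.
pose x1 := `|M| + 1; have x10 : 0 < x1 by rewrite ltr_wpDl.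
exists x1 => // x x0; have [xx1|x1x] := leP x x1.
  apply: (le_trans _ (Pge0 _ x0)).
  by rewrite lee_fin subr_le0 ler_pdivrMr// mul1r.
have xgt0 := lt_trans x10 x1x.
have P1 : (1 <= Phi x1)%E by apply: PM; rewrite ltr_pwDr// ler_norm.
have := le_trans P1 (young_le_scale (ltW x10) (ltW x1x) xgt0).
have := Pge0 _ x0; case: (Phi x) => [r r0|_ _|//]; last by rewrite leey.
rewrite -EFinM !lee_fin => h.
apply: (@le_trans _ _ (x / x1)); first by rewrite gerBl.
rewrite ler_pdivrMr//.
by move: h; rewrite mulrAC ler_pdivlMr// mul1r mulrC.
Qed.

(** Values at negative reals are arbitrary, hence the truncation; by monotonicity the superlevel
    sets are intervals. *)
Lemma young_measurable :
  measurable_fun setT (fun x : R => Phi (Order.max 0 x)).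
Proof.
apply: (measurability _ (ErealGenOInfty.measurableE R)) => //.
move=> _ [_ [a ->]] <-; rewrite setTI; apply: is_interval_measurable.
move=> x y /= Px Py z /andP[xz zy]; move: Px; rewrite !in_itv/= !andbT => Px.
apply: (lt_le_trans Px); apply: young_nondecreasing.
  by rewrite le_max lexx.
by rewrite ge_max le_max lexx/= le_max xz orbT.
Qed.

End young.

Section complex_parts.
Context {R : realType}.

Definition part (b : bool) (z : Cplx R) : R := if b then cRe z else cIm z.

Lemma part_le_cabs b z : `|part b z| <= cabs z.
Proof.
rewrite /cabs -sqrtr_sqr; apply: ler_wsqrtr.
by case: b; rewrite ?lerDl ?lerDr sqr_ge0.
Qed.

End complex_parts.

Section luxemburg.
Context {R : realType} {T : ptopologicalType}
  (m : {finite_measure set (Borel T) -> \bar R}) (mT : m [set: T] = 1%E)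
  (Phi : R -> \bar R) (Y : young_function Phi).

(** Integrating the linear bound at [cabs (w t) / k] over total mass 1 gives at most 1 + 1 for the
    integral of the absolute value of [g] divided by [x1 * k]; hence the factor 2. *)
Lemma modular_L1 (x1 k : R) (w : T -> Cplx R) (g : T -> R) :
  0 < x1 -> (forall x, 0 <= x -> ((x / x1 - 1)%:E <= Phi x)%E) -> 0 < k ->
  (\int[m]_(x in [set: Borel T]) Phi (cabs (w x) / k)%R <= 1)%E ->
  measurable_fun setT (g : Borel T -> R) -> (forall t, `|g t| <= cabs (w t)) ->
  (\int[m]_(t in [set: Borel T]) `|g t|%:E <= (2 * x1 * k)%:E)%E.
Proof.
move=> x10 Plin k0 Pk mg gw.
have xk0 : 0 < x1 * k by rewrite mulr_gt0.
have Pge0 x : 0 <= x -> (0 <= Phi x)%E by case: Y => _ + _ _; apply.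
(* A nonnegative measurable minorant of the modular integrand, which need not be measurable because
   nothing is assumed of [w]. *)
pose f t := Num.max (`|g t| / (x1 * k) - 1) 0.
have mng : measurable_fun setT (fun t : Borel T => `|g t|).
  exact: measurableT_comp.
have mf : measurable_fun setT (f : Borel T -> R).
  apply: measurable_maxr => //; apply: measurable_funB => //.
  exact: measurable_funM.
have f0 t : 0 <= f t by rewrite /f le_max lexx orbT.
have f1 : (\int[m]_(t in [set: Borel T]) (f t)%:E <= 1)%E.
  apply: le_trans Pk; apply: le_lower_integral => t; first by rewrite lee_fin.
  have c0 : 0 <= cabs (w t) / k by rewrite divr_ge0 ?sqrtr_ge0// ltW.
  rewrite /f EFin_max ge_max (Pge0 _ c0) andbT.
  apply: le_trans (Plin _ c0); rewrite lee_fin lerD2r.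
  rewrite -mulrA -invfM [k * x1]mulrC; apply: ler_wpM2r => //.
  by rewrite invr_ge0 ltW.
apply: (@le_trans _ _ (\int[m]_(t in [set: Borel T])
    ((x1 * k)%:E * ((f t)%:E + 1)))%E).
  apply: ge0_le_integral => //.
  - exact/measurable_EFinP.
  - apply: emeasurable_funM => //; apply: emeasurable_funD => //.
    exact/measurable_EFinP.
  move=> t _; rewrite -EFinD -EFinM lee_fin -ler_pdivrMl// [leLHS]mulrC.
  by rewrite -lerBlDr /f le_max lexx.
rewrite ge0_integralZl//; last 3 first.
- by apply: emeasurable_funD => //; exact/measurable_EFinP.
- by move=> t _; rewrite adde_ge0// lee_fin.
- by rewrite lee_fin ltW.
rewrite ge0_integralD//; last 2 first.
- by move=> t _; rewrite lee_fin.
- exact/measurable_EFinP.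
rewrite integral_cst// mul1e [X in (_ + X)%E](_ : _ = 1%E); last exact: mT.
have -> : (2 * x1 * k)%:E = ((x1 * k)%:E * 2%:E)%E.
  by rewrite -EFinM; congr EFin; rewrite [RHS]mulrC mulrA.
apply: lee_wpmul2l; first by rewrite lee_fin ltW.
by rewrite (_ : 2%:E = 1 + 1)%E ?leeD2r.
Qed.

Lemma in_Orlicz_part_integrable w b : in_Orlicz Phi m w ->
  m.-integrable setT (EFin \o (fun t : Borel T => part b (w t))).
Proof.
move=> [mre mim /ereal_inf_lt[_ [k [k0 Pk] <-] _]].
have mp : measurable_fun setT (fun t : Borel T => part b (w t)) by case: b.
have [x1 x10 Plin] := young_linear_bound Y.
apply/integrableP; split; first exact/measurable_EFinP.
have := modular_L1 x10 Plin k0 Pk mp (fun t => part_le_cabs b (w t)).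
by move=> /le_lt_trans; apply; exact: ltry.
Qed.

Lemma luxemburg_L1 (x1 : R) (w : T -> Cplx R) (g : T -> R) :
  0 < x1 -> (forall x, 0 <= x -> ((x / x1 - 1)%:E <= Phi x)%E) ->
  m.-integrable setT (EFin \o (g : Borel T -> R)) ->
  (forall t, `|g t| <= cabs (w t)) ->
  (((2 * x1)^-1 * \int[m]_(t in [set: Borel T]) `|g t|)%:E
    <= luxemburg_norm Phi m w)%E.
Proof.
move=> x10 Plin ig gw; apply: le_ereal_inf_tmp => _ [k [k0 Pk] <-].
have /measurable_int/measurable_EFinP mg := ig.
have := modular_L1 x10 Plin k0 Pk mg gw.
rewrite lee_fin ler_pdivrMl ?mulr_gt0// -lee_fin; apply: le_trans.
rewrite /Rintegral fineK//; apply: integrable_fin_num => //.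
exact: (integrable_norm ig).
Qed.

End luxemburg.

(** * Real and imaginary parts of Bochner approximations *)

Section bochner_parts.
Context {R : realType} {T : ptopologicalType}
  (m : {finite_measure set (Borel T) -> \bar R}) (mT : m [set: T] = 1%E)
  (Phi : R -> \bar R) (Y : young_function Phi).

Definition part_simple (b : bool) (s : lsimple)
    : seq (set (Borel T) * (Borel T -> R)) :=
  [seq (p.1, fun t => part b (p.2 t)) | p <- s].

Lemma part_csub b (f g : T -> Cplx R) t :
  part b (csub f g t) = part b (f t) - part b (g t).
Proof. by case: b. Qed.

Lemma part_lsimple_eval b s (x t : T) :
  part b (lsimple_eval s x t) = rsimple_eval (part_simple b s) x t.
Proof. by rewrite /rsimple_eval big_map; case: b. Qed.

Lemma part_lsimple_int b s (A : set T) t :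
  part b (lsimple_int m s A t) = rsimple_int m (part_simple b s) A t.
Proof. by rewrite /rsimple_int big_map; case: b. Qed.

Lemma part_simple_ok b s : lsimple_ok Phi m s -> rsimple_ok m (part_simple b s).
Proof.
elim: s => [_ p []|q s ih oks p /= [<-|ps]].
  have [mq oq] := oks q (or_introl erefl).
  by split => //; exact: (in_Orlicz_part_integrable mT Y b oq).
by apply: ih ps => r rs; apply: oks; right.
Qed.

Context (F : T -> T -> Cplx R).

Lemma bochner_approx_L1 b Fn : bochner_approx Phi m F Fn ->
  L1_approx m (fun x t => part b (F x t)) (fun n => part_simple b (Fn n)).
Proof.
move=> [okF oF aeF intF]; have [x1 x10 Plin] := young_linear_bound Y.
exists (2 * x1)^-1,
  (fun n x => luxemburg_norm Phi m (csub (lsimple_eval (Fn n) x) (F x))).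
split => //.
- by rewrite invr_gt0 mulr_gt0.
- by move=> n; exact: part_simple_ok.
move=> n x; apply: luxemburg_L1 => //.
  apply: integrable_EFinB; last exact: (in_Orlicz_part_integrable mT Y b (oF x)).
  by apply: rsimple_eval_integrable; exact: part_simple_ok.
by move=> t; rewrite -part_lsimple_eval -part_csub; exact: part_le_cabs.
Qed.

End bochner_parts.

(** * From the real components to the complex measure *)

Section bochner_convolution.
Context {R : realType} {T : ptopologicalType} (mul : T -> T -> T) (inv : T -> T)
  (e : T) (tg : topological_group mul inv e).
Context (hT : hausdorff_space T) (cT : compact [set: T])
  (m : {finite_measure set (Borel T) -> \bar R})
  (mT : m [set: T] = 1%E) (rm : regular_measure m)
  (linv : forall (x : T) (A : set (Borel T)), measurable A ->
    m (mul x @` A) = m A).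
Context (Phi : R -> \bar R) (Y : young_function Phi) (F : T -> T -> Cplx R)
  (mu1 mu2 mu3 mu4 : {finite_measure set (Borel T) -> \bar R})
  (r1 : regular_measure mu1) (r2 : regular_measure mu2)
  (r3 : regular_measure mu3) (r4 : regular_measure mu4).

(** By right invariance the modular is unchanged, so the same [k] is admissible. *)
Lemma in_Orlicz_right_translate (f : T -> Cplx R) y :
  in_Orlicz Phi m f -> in_Orlicz Phi m (fun t => f (mul t y)).
Proof.
have mr := continuous_Borel_Borel (@continuous_mulr _ _ _ _ tg y).
move=> [mre mim /ereal_inf_lt[_ [k [k0 Pk] <-] _]]; split.
- exact: (measurableT_comp mre mr).
- exact: (measurableT_comp mim mr).
apply: (@le_lt_trans _ _ k%:E); last exact: ltry.
apply: ereal_inf_lbound; exists k => //; split => //.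
have E t : Phi (cabs (f t) / k) = Phi (Order.max 0 (cabs (f t) / k)).
  by rewrite max_r// divr_ge0 ?sqrtr_ge0// ltW.
rewrite (ge0_integral_right_invariant tg hT cT mT rm linv
  (f := fun t => Phi (cabs (f t) / k)))//.
  under eq_fun do rewrite E.
  apply: (measurableT_comp (young_measurable Y)).
  apply: measurable_funM => //.
  apply: (measurableT_comp (continuous_measurable_fun (@sqrt_continuous R))).
  by apply: measurable_funD; exact: measurable_funX.
move=> t; have [_ + _ _] := Y; apply.
by rewrite divr_ge0 ?sqrtr_ge0// ltW.
Qed.

Lemma bochner_convolution_density :
  bochner_integrable Phi m F ->
  (forall A : set (Borel T), measurable A ->
     is_bochner_integral Phi m F A (nu_mu mul inv mu1 mu2 mu3 mu4 A)) ->
  exists f : T -> Cplx R,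
    [/\ in_Orlicz Phi m f,
        m.-integrable [set: Borel T] (fun x => (cRe (f x))%:E),
        m.-integrable [set: Borel T] (fun x => (cIm (f x))%:E) &
        forall A : set (Borel T), measurable A ->
          cmeasure_val mu1 mu2 mu3 mu4 A =
          complex.Complex (fine (\int[m]_(x in A) (cRe (f x))%:E))
                          (fine (\int[m]_(x in A) (cIm (f x))%:E))].
Proof.
move=> [Fn [_ oF _ _]] HF.
have [x1 x10 Plin] := young_linear_bound Y.
pose mua b := if b then mu1 else mu3; pose mub b := if b then mu2 else mu4.
have ra b : regular_measure (mua b) by case: b.
have rb b : regular_measure (mub b) by case: b.
have iF b x : m.-integrable setT (EFin \o (fun t : Borel T => part b (F x t))).
  exact: (in_Orlicz_part_integrable mT Y b (oF x)).
have dens b : {ae m, forall x : Borel T, forall A : set (Borel T), measurable A ->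
    fine (mua b A) - fine (mub b A)
    = \int[m]_(t in A) part b (F x (mul t x))}.
  apply: (convolution_density_ae tg hT cT mT rm linv (ra b) (rb b)
    (H := fun x t => part b (F x t))) => // U oU.
  have [S [SF SU]] := HF U (open_Borel oU).
  exists (fun n => part_simple b (S n)); split.
    exact: (bochner_approx_L1 mT Y b SF).
  exists (2 * x1)^-1, (fun n => luxemburg_norm Phi m
    (csub (lsimple_int m (S n) U) (nu_mu mul inv mu1 mu2 mu3 mu4 U))).
  split => //; first by rewrite invr_gt0 mulr_gt0.
  have nuE t : part b (nu_mu mul inv mu1 mu2 mu3 mu4 U t)
      = conv_diff mul inv (mua b) (mub b) \1_U t by case: b.
  move=> n; apply: (luxemburg_L1 mT Y) => //.
    apply: integrable_EFinB.
      apply: rsimple_int_integrable; apply: (part_simple_ok mT Y).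
      by have [oks _ _ _] := SF; exact: oks.
    exact: (conv_diff_open_integrable tg hT m (ra b) (rb b) oU).
  by move=> t; rewrite -nuE -part_lsimple_int -part_csub; exact: part_le_cabs.
have [x [dx1 dx2]] : exists x : T,
    (forall A : set (Borel T), measurable A -> fine (mu1 A) - fine (mu2 A)
      = \int[m]_(t in A) part true (F x (mul t x))) /\
    (forall A : set (Borel T), measurable A -> fine (mu3 A) - fine (mu4 A)
      = \int[m]_(t in A) part false (F x (mul t x))).
  apply: contrapT => nx.
  (* If no point were good for both components, a null set would contain the whole group, which has
     mass 1. *)
  have := filterI (dens true) (dens false).
  move=> [N [mN N0 sub]].
  have : (m [set: T] <= m N)%E.
    apply: le_measure; rewrite ?inE// => x _; apply: sub => /= dx.
    by apply: nx; exists x.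
  by rewrite N0 mT lee_fin ler10.
have oFx := in_Orlicz_right_translate x (oF x).
exists (fun t => F x (mul t x)); split => //.
- exact: (in_Orlicz_part_integrable mT Y true oFx).
- exact: (in_Orlicz_part_integrable mT Y false oFx).
- by move=> A mA; rewrite /cmeasure_val dx1// dx2.
Qed.

End bochner_convolution.

Theorem theorem4p4 (R : realType) (T : ptopologicalType)
  (mul : T -> T -> T) (inv : T -> T) (e : T)
  (m : {measure set (Borel T) -> \bar R})
  (Phi Psi : R -> \bar R)
  (mu1 mu2 mu3 mu4 : {finite_measure set (Borel T) -> \bar R})
  (F : T -> T -> Cplx R) :
  hausdorff_space T -> compact [set: T] -> topological_group mul inv e ->
  normalized_haar mul m ->
  complementary_pair Phi Psi -> Delta2 Phi -> Delta2 Psi ->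
  radon mu1 -> radon mu2 -> radon mu3 -> radon mu4 ->
  bochner_integrable Phi m F ->
  (forall A : set (Borel T), measurable A ->
     is_bochner_integral Phi m F A (nu_mu mul inv mu1 mu2 mu3 mu4 A)) ->
  exists f : T -> Cplx R,
    [/\ in_Orlicz Phi m f,
        m.-integrable [set: Borel T] (fun x => (cRe (f x))%:E),
        m.-integrable [set: Borel T] (fun x => (cIm (f x))%:E) &
        forall A : set (Borel T), measurable A ->
          cmeasure_val mu1 mu2 mu3 mu4 A =
          complex.Complex (fine (\int[m]_(x in A) (cRe (f x))%:E))
                          (fine (\int[m]_(x in A) (cIm (f x))%:E))].
Proof.
move=> hT cT tg haar [Y _ _] _ _ rd1 rd2 rd3 rd4.
have [mT _ _] := haar.
have [|nu nuE] := @finite_measure_of _ (Borel T) R m.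
  by rewrite [X in (X < _)%E](_ : _ = 1%E)//; exact: ltry.
(* The equality is between bundled measures, so [m] can be replaced inside the Bochner hypotheses as
   well. *)
have {nuE} mE : m = nu by apply: eq_measure; rewrite -nuE.
move: haar; rewrite {}mE => -[nuT rnu linv] bF HF.
exact: (bochner_convolution_density tg hT cT nuT (radon_regular hT rnu) linv Y
  (radon_regular hT rd1) (radon_regular hT rd2) (radon_regular hT rd3)
  (radon_regular hT rd4) bF HF).
Qed.
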